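(* Consider noisy SGD with random sparsification on a $G$-smooth function $\mathcal L$ with isotropic Gaussian noise $\xi_\sigma\sim\mathcal N(0,\sigma^2I_d)$, learning rate $\gamma=\frac1{G\sqrt T}$, batch size $B$ and sparsification rate $r$, i.e. $$w_{t+1}=w_t-\gamma\,m\odot\Big(\frac1B\Big(\sum_{i=1}^B g_{t,i}+\xi_\sigma\Big)\Big),\qquad t=1,\dots,T.$$ Assume an upper bound on the individual gradient deviation, $\|\xi_t\|^2\le\sigma_g^2$. Then $$\frac1T\sum_{t=1}^T\|\nabla w_t\|^2\le\frac{2G}{(1-r)\sqrt T}\,\Delta_{\mathcal L}+\frac1{\sqrt T}\Big(\frac{\sigma_g^2}{B}+\frac{d\sigma^2}{B^2}\Big),$$ where $\Delta_{\mathcal L}:=\mathbb E[\mathcal L(w_1)]-\min_w\mathcal L(w)$.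
   Context: $\|\cdot\|$ is the Euclidean norm and $\odot$ the entrywise product. The objective is $\mathcal L(w)=\mathbb E_{x\in\mathcal X}[\ell(w;x)]$ with $w\in\mathbb R^d$, where $x$ is a training example sampled from the dataset $\mathcal X$; $G$-smooth means that $\nabla\mathcal L$ is $G$-Lipschitz. At step $t$, $g_{t,i}:=\nabla\ell(w_t;x_i)$ is the gradient for example $x_i$ of the batch and $\nabla w_t:=\mathbb E_{x\in\mathcal X}[g_{t,i}]$ is the true gradient. The gradient deviation $g_{t,i}-\nabla w_t$ is assumed to be sampled from a zero-mean random variable $\xi_t$. Random sparsification with rate $r$: $m\in\{0,1\}^d$ is a random mask in which $rd$ uniformly drawn positions are set to $0$ and the others to $1$, so $\|m\|_1=(1-r)d$.
   Formalization: The iterates are random, so the bound is stated for the expectation of the left-hand side, (1/T) Σ E‖∇w_t‖²; without the expectation it fails for Gaussian noise. Batch examples, masks, noises and w_1 are taken independent, and r<1. *)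

(* Defs.v *)
From HB Require Import structures.
From mathcomp Require Export all_boot all_order all_algebra.
From mathcomp Require Export all_classical all_reals all_analysis.

Set Implicit Arguments.
Unset Strict Implicit.
Unset Printing Implicit Defensive.

Import Order.TTheory GRing.Theory Num.Theory.
Export numFieldNormedType.Exports.

Local Open Scope classical_set_scope.
Local Open Scope ring_scope.

Section euclidean.
Context {R : realType} {n : nat}.
Implicit Types (u v : 'rV[R]_n) (f : 'rV[R]_n -> R).

(* The library norm on ['rV[R]_n] is the sup norm. *)
Definition norm2 u : R := Num.sqrt (\sum_(j < n) u 0 j ^+ 2).

Definition hadamard u v : 'rV[R]_n := map2_mx *%R u v.

Definition grad f u : 'rV[R]_n := \row_(j < n) 'D_(delta_mx 0 j) f u.

Definition smooth (G : R) f : Prop :=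
  (forall u, differentiable f u) /\
  (forall u v, norm2 (grad f u - grad f v) <= G * norm2 (u - v)).

End euclidean.

Section probability.
Context {R : realType} {d : measure_display} {Omega : measurableType d}.
Variable P : probability Omega R.

(* Mutual independence of the set systems [F i], for [i] in [D]. *)
Definition mutually_independent (I : eqType) (D : set I)
    (F : I -> set (set Omega)) : Prop :=
  forall (J : seq I) (A : I -> set Omega), uniq J ->
    (forall i, i \in J -> D i /\ F i (A i)) ->
    P (\big[setI/setT]_(i <- J) A i) = (\prod_(i <- J) P (A i))%E.

Definition coord n (X : Omega -> 'rV[R]_n) (j : 'I_n) : Omega -> R :=
  fun omega => X omega 0 j.

Definition random_vector n (X : Omega -> 'rV[R]_n) : Prop :=
  forall j, measurable_fun setT (coord X j).

(* [normal_prob m 0] is a dummy (uniform) law in the library; the variance 0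
   case is the point mass. *)
Definition normal_law (m s : R) (A : set R) : \bar R :=
  if s == 0 then \d_m A else normal_prob m s A.

(* The law N(0, s^2 I_n). *)
Definition isotropic_gaussian n (s : R) (X : Omega -> 'rV[R]_n) : Prop :=
  [/\ random_vector X,
      forall j (A : set R), measurable A ->
        P (coord X j @^-1` A) = normal_law 0 s A
    & mutually_independent setT
        (fun j => preimage_set_system setT (coord X j) measurable)].

(* [Z] is uniform among the [k]-element subsets of the [n] positions. *)
Definition uniform_positions n (k : nat) (Z : Omega -> {set 'I_n}) : Prop :=
  forall S : {set 'I_n}, measurable (Z @^-1` [set S]) /\
    P (Z @^-1` [set S]) = (if #|S| == k then ('C(n, k)%:R^-1)%:E else 0%E).

End probability.

(* The 0-1 mask vanishing exactly on [Z]. *)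
Definition mask_of {R : realType} n (Z : {set 'I_n}) : 'rV[R]_n :=
  \row_(j < n) (j \notin Z)%:R.

Section objective.
Context {R : realType} {n : nat} {d : measure_display} {X : measurableType d}.
Variables (D : probability X R) (loss : 'rV[R]_n -> X -> R).

Definition objective (w : 'rV[R]_n) : R := fine 'E_D[loss w].

Definition example_grad (w : 'rV[R]_n) (x : X) : 'rV[R]_n :=
  grad (loss ^~ x) w.

Definition true_grad (w : 'rV[R]_n) : 'rV[R]_n :=
  \row_(j < n) fine 'E_D[fun x => example_grad w x 0 j].

End objective.

(* The sources of randomness of a run: the initial point and, at each step,
   the mask, the examples of the batch and the noise. *)
Inductive source (B : nat) : Type :=
| Init
| Mask of nat
| Example of nat & 'I_B
| Noise of nat.
Arguments Init {B}.
Arguments Mask {B} _.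
Arguments Noise {B} _.

HB.instance Definition _ (B : nat) := gen_eqMixin (source B).

Definition sources_upto (B T : nat) : set (source B) :=
  fun s => match s with
  | Init => True
  | Mask t | Noise t | Example t _ => (1 <= t <= T)%N
  end.

Section run.
Context {R : realType} {dO : measure_display} {Omega : measurableType dO}.
Context {dX : measure_display} {X : measurableType dX} {n B : nat}.

(* The sigma-algebra generated by each source. *)
Definition source_sigma (w1 : Omega -> 'rV[R]_n) (Z : nat -> Omega -> {set 'I_n})
    (x : nat -> 'I_B -> Omega -> X) (xi : nat -> Omega -> 'rV[R]_n)
    (s : source B) : set (set Omega) :=
  match s with
  | Init => g_sigma_preimage (coord w1)
  | Mask t => preimage_set_system setT (Z t) setT
  | Example t i => preimage_set_system setT (x t i) measurable
  | Noise t => g_sigma_preimage (coord (xi t))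
  end.

End run.

(* Main.v *)
(* Smoothness gives the descent inequality
     L(w_{t+1}) <= L(w_t) - gamma <grad L(w_t), m o v> + (G/2) gamma^2 |m o v|^2
   for the batch direction v = grad L(w_t) + (sum_i delta_i + xi)/B. The mask is
   independent of w_t and v, so its expectation contributes the factor 1 - r to
   both terms. The deviations delta_i are centred given the other sources, so all
   cross terms vanish and E|v|^2 <= E|grad L(w_t)|^2 + sigma_g^2/B + d sigma^2/B^2.
   Since gamma G <= 1, summing over t telescopes. When E L(w_1) = +oo the bound is
   trivial; otherwise |grad L|^2 <= 2G (L - Lmin) makes everything integrable.

   Each cancellation isolates one source: independence of that source from the
   sigma-algebra generated by all the others (pi-lambda), then Fubini. *)
Require Import Defs.
From mathcomp Require Import ring lra measurable_realfun.

Set Implicit Arguments.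
Unset Strict Implicit.
Unset Printing Implicit Defensive.

Import Order.TTheory GRing.Theory Num.Theory.

Local Open Scope classical_set_scope.
Local Open Scope ring_scope.

(** * Smooth functions *)

(** No conditional expectation appears. Each is a Fubini integral in which everything but one source
    is frozen, so the gradient of an example must be jointly measurable in the iterate and the
    example. The hypotheses only give measurability in the example and differentiability in the
    weights; the rounding argument below bridges this gap.

    The Gaussian mean and the bound on its second moment are read off the moment generating function
    near 0 by elementary inequalities.

    Integrability of the loss along the run is not a hypothesis: it passes from [w t] to [w t.+1]
    together with the descent inequality.

    The constants come from dividing the summed inequality by (1 - r) gamma T / 2: with gamma = 1 /
    (G sqrt T), the initial gap gets 2 / ((1 - r) gamma T) = 2 G / ((1 - r) sqrt T) and the noise
    gets G gamma = 1 / sqrt T. *)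

Section calculus.
Context {R : realType} {n : nat}.
Implicit Types (u v h : 'rV[R]_n) (f : 'rV[R]_n -> R).

Lemma norm2_sqr u : norm2 u ^+ 2 = \sum_(j < n) u 0 j ^+ 2.
Proof. by rewrite sqr_sqrtr// sumr_ge0// => j _; exact: sqr_ge0. Qed.

Lemma derive_grad f u h : differentiable f u ->
  'D_h f u = \sum_(j < n) grad f u 0 j * h 0 j.
Proof.
move=> df; rewrite deriveE// {1}(row_sum_delta h) linear_sum/=.
by apply: eq_bigr => j _; rewrite linearZ/= mxE deriveE// mulrC.
Qed.

Lemma is_derive_line f u h (s : R) : differentiable f (u + s *: h) ->
  is_derive s 1 (fun s => f (u + s *: h)) ('D_h f (u + s *: h)).
Proof.
move=> df; have dh : derivable f (u + s *: h) h by exact: diff_derivable.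
have E : (fun t : R => t^-1 *: (f (u + (t *: (1:R) + s) *: h) - f (u + s *: h)))
   = (fun t => t^-1 *: (f (t *: h + (u + s *: h)) - f (u + s *: h))).
  by apply/funext => t; rewrite scalerDl [t *: 1]mulr1 addrCA.
by apply: DeriveDef; rewrite /derivable/derive/= E.
Qed.

(** Young's inequality in place of Cauchy-Schwarz: expanding (u_j - c v_j)^2 >= 0 and summing gives
    2 c <u,v> <= |u|^2 + c^2 |v|^2, and the hypothesis bounds the right side by 2 c^2 |v|^2. *)
Lemma dot_le_of_norm2_le (c : R) u v : 0 < c -> norm2 u <= c * norm2 v ->
  \sum_(j < n) u 0 j * v 0 j <= c * norm2 v ^+ 2.
Proof.
move=> c0 uv.
have {}uv : norm2 u ^+ 2 <= c ^+ 2 * norm2 v ^+ 2.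
  by rewrite -exprMn lerXn2r ?nnegrE ?sqrtr_ge0// (le_trans _ uv)// sqrtr_ge0.
rewrite -(ler_pM2l (mulr_gt0 (ltr0n R 2) c0)).
apply: (@le_trans _ _ (norm2 u ^+ 2 + c ^+ 2 * norm2 v ^+ 2)); last by nra.
rewrite !norm2_sqr !mulr_sumr -big_split/=; apply: ler_sum => j _.
have := sqr_ge0 (u 0 j - c * v 0 j); nra.
Qed.

(* On the segment from [u] to [u + h], the Lipschitz bound gives
   <grad f (u + s h) - grad f u, h> <= G s |h|^2; integrate in [s]. *)
Lemma smooth_descent (G : R) f u h : 0 < G -> smooth G f ->
  f (u + h) <= f u + \sum_(j < n) grad f u 0 j * h 0 j + G / 2 * norm2 h ^+ 2.
Proof.
move=> G0 [df lf].
pose a := \sum_(j < n) grad f u 0 j * h 0 j.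
(* The quadratic upper bound minus [f] along the segment, up to the constant [f u]; the claim is
   [phi 0 <= phi 1], so a nonnegative derivative suffices. *)
pose phi (s : R) : R := a * s + G / 2 * norm2 h ^+ 2 * s ^+ 2 - f (u + s *: h).
have dphi (s : R) : is_derive s (1:R) phi
    (a + G * norm2 h ^+ 2 * s - 'D_h f (u + s *: h)).
  have d1 := is_derive_line (df (u + s *: h)).
  apply: is_derive_eq.
  rewrite /GRing.scale/= !mulr1; congr (_ - _).
  by field; rewrite ?pnatr_eq0.
have phi0 : phi 0 = - f u.
  by rewrite /phi !mulr0 expr0n/= mulr0 scale0r !addr0 add0r.
have phi1 : phi 1 = a + G / 2 * norm2 h ^+ 2 - f (u + h).
  by rewrite /phi expr1n !mulr1 scale1r.
suff : phi 0 <= phi 1 by rewrite phi0 phi1 -/a; lra.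
clearbody phi; apply: (@ger0_derive1_ndecr R phi 0 1); rewrite ?ler01 ?lexx//.
- move=> z; rewrite in_itv/= => /andP[s0 _].
  rewrite derive1E (@derive_val _ _ _ _ _ _ _ (dphi z)) derive_grad//.
  have := @dot_le_of_norm2_le (G * z) (grad f (u + z *: h) - grad f u) h.
  rewrite mulr_gt0//; move=> /(_ isT); have := lf (u + z *: h) u.
  have -> : norm2 (u + z *: h - u) = z * norm2 h.
    rewrite addrC addKr /norm2; under eq_bigr do rewrite mxE exprMn.
    by rewrite -mulr_sumr sqrtrM ?sqr_ge0// sqrtr_sqr gtr0_norm.
  rewrite mulrA => -> /(_ isT).
  under eq_bigr do rewrite !mxE mulrBl.
  have aE : \sum_(j < n) 'D_(delta_mx 0 j) f u * h 0 j = a.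
    by apply: eq_bigr => j _; rewrite mxE.
  rewrite sumrB aE; under [X in _ -> _ <= _ - X]eq_bigr do rewrite mxE.
  lra.
- apply: continuous_subspaceT => z.
  apply: differentiable_continuous; apply/derivable1_diffP.
  exact: (@ex_derive _ _ _ _ _ _ _ (dphi z)).
Qed.

(** The step - grad f(u) / G minimises the quadratic upper bound of [smooth_descent]; the value
    reached there is still at least [m]. *)
Lemma norm2_grad_le (G m : R) f u : 0 < G -> smooth G f ->
  (forall v, m <= f v) -> norm2 (grad f u) ^+ 2 <= 2 * G * (f u - m).
Proof.
move=> G0 sf mf.
have := smooth_descent u (- G^-1 *: grad f u) G0 sf.
have hE j : (- G^-1 *: grad f u) 0 j = - G^-1 * grad f u 0 j.
  by rewrite [LHS]mxE.
move=> /(le_trans (mf _)); rewrite !norm2_sqr.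
under eq_bigr do rewrite hE mulrCA -expr2.
under [X in _ + G / 2 * X]eq_bigr do rewrite hE exprMn.
rewrite -!mulr_sumr; set S := \sum_(_ < _) _ => mS.
have {}mS : m <= f u - S / (2 * G).
  rewrite (le_trans mS)// sqrrN le_eqVlt; apply/orP; left; apply/eqP.
  by field; rewrite gt_eqF.
rewrite -ler_pdivrMl ?mulr_gt0//; lra.
Qed.

End calculus.

(** * Joint measurability *)

Section caratheodory.
Context {R : realType} {n : nat} {dT dX : measure_display}.
Context {T : measurableType dT} {X : measurableType dX}.

(* Rounding the first argument down to the grid of mesh 1/(N+1) makes it
   countably valued, and a function continuous in it is the limit as N grows. *)
Definition grid (N : nat) (c : 'rV[int]_n) : 'rV[R]_n :=
  \row_j ((c 0 j)%:~R / N.+1%:R).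
Definition cell (N : nat) (v : 'rV[R]_n) : 'rV[int]_n :=
  \row_j Num.floor (v 0 j * N.+1%:R).

Lemma cvg_grid_cell (v : 'rV[R]_n) :
  grid N (cell N v) @[N --> \oo] --> v.
Proof.
apply/cvgrPdist_le => e e0.
have [M M0] : exists M : nat, e^-1 <= M%:R.
  by exists (Num.bound e^-1); rewrite ltW// archi_boundP// invr_ge0 ltW.
exists M => // N /= MN.
rewrite /Num.norm/= mx_normrE; apply/bigmax_leP; split => [|i _]; first exact: ltW.
rewrite !mxE/= (ord1 i.1); set x := v 0 i.2.
have N0 : 0 < N.+1%:R :> R by rewrite ltr0n.
have /andP[fl fu] := floor_itv (x * N.+1%:R).
rewrite ger0_norm; last by rewrite subr_ge0 ler_pdivrMr.
rewrite -(ler_pM2r N0) mulrBl divfK ?gt_eqF//.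
rewrite intrD in fu; apply: (@le_trans _ _ 1); first lra.
rewrite -ler_pdivrMl// mulr1 (le_trans M0)// ler_nat; exact: leqW.
Qed.

(** On each of the countably many cells the rounded function is a fixed section [f v] composed with
    [y], hence measurable. A cell is a finite intersection of preimages of half-open intervals. *)
Lemma measurable_caratheodory (f : 'rV[R]_n -> X -> R) (w : T -> 'rV[R]_n)
    (y : T -> X) :
  (forall z, continuous (f ^~ z)) -> (forall v, measurable_fun setT (f v)) ->
  (forall j, measurable_fun setT (fun t => w t 0 j)) ->
  measurable_fun setT y -> measurable_fun setT (fun t => f (w t) (y t)).
Proof.
move=> fc fm wm ym.
apply: (@measurable_fun_cvg _ _ _ _ (fun N t => f (grid N (cell N (w t))) (y t)));
  last first.
  move=> t _; have fct : f v (y t) @[v --> w t] --> f (w t) (y t) by exact: (fc (y t)).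
  have := @cvg_comp _ _ _ (fun N => grid N (cell N (w t))) (f^~ (y t)).
  apply; first exact: cvg_grid_cell.
  exact: fct.
move=> N _ A mA; rewrite setTI.
have -> : (fun t => f (grid N (cell N (w t))) (y t)) @^-1` A =
    \bigcup_(c : 'rV[int]_n) ([set t | cell N (w t) = c] `&`
       (fun t => f (grid N c) (y t)) @^-1` A).
  apply/seteqP; split => [t/= At|t [c _ [/= <-]]//].
  by exists (cell N (w t)).
apply: countable_bigcupT_measurable; first exact: countableP.
move=> c; apply: measurableI; last first.
  rewrite -[X in measurable X]setTI.
  exact: (measurableT_comp (fm (grid N c)) ym).
have -> : [set t | cell N (w t) = c] =
    \bigcap_(j in [set: 'I_n]) ((fun t => w t 0 j * N.+1%:R) @^-1`
      [set x | Num.floor x = c 0 j]).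
  apply/seteqP; split => t /=.
    by move=> <- j _ /=; rewrite mxE.
  by move=> ct; apply/rowP => j; rewrite mxE; exact: ct.
apply: fin_bigcap_measurable; first exact: finite_finset.
move=> j _.
rewrite -[X in measurable X]setTI.
have mj : measurable_fun setT (fun t => w t 0 j * N.+1%:R).
  by apply: measurable_funM.
apply: mj => //.
have -> : [set x : R | Num.floor x = c 0 j] =
    `[(c 0 j)%:~R, (c 0 j + 1)%:~R[%classic.
  by apply/seteqP; split => x /=; rewrite in_itv/= -floor_eq => /eqP.
exact: measurable_itv.
Qed.

Lemma continuous_of_differentiable (f : 'rV[R]_n -> R) :
  (forall v, differentiable f v) -> continuous f.
Proof. by move=> df v; exact: differentiable_continuous. Qed.

(** A partial derivative is the limit of difference quotients along the harmonic sequence, and each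
    quotient is measurable by the previous lemma. *)
Lemma measurable_example_grad (f : 'rV[R]_n -> X -> R) (w : T -> 'rV[R]_n)
    (y : T -> X) (j : 'I_n) :
  (forall v z, differentiable (f ^~ z) v) -> (forall v, measurable_fun setT (f v)) ->
  (forall j, measurable_fun setT (fun t => w t 0 j)) ->
  measurable_fun setT y ->
  measurable_fun setT (fun t => example_grad f (w t) (y t) 0 j).
Proof.
move=> df fm wm ym.
have cf z : continuous (f ^~ z) by apply: continuous_of_differentiable.
have mf : measurable_fun setT (fun t => f (w t) (y t)).
  exact: measurable_caratheodory.
pose q N t := (harmonic N)^-1 *:
  (f (harmonic N *: delta_mx 0 j + w t) (y t) - f (w t) (y t)).
apply: (@measurable_fun_cvg _ _ _ _ q).
  move=> N; apply: measurable_funM => //; apply: measurable_funB => //.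
  apply: measurable_caratheodory => // i.
  under eq_fun do rewrite !mxE.
  by apply: measurable_funD.
move=> t _; rewrite /example_grad mxE.
have : derivable (f ^~ (y t)) (w t) (delta_mx 0 j) by exact: diff_derivable.
move=> /cvgr_dnbhsP /(_ (@harmonic R)); apply; split => [N|].
  by rewrite gt_eqF// harmonic_gt0.
exact: cvg_harmonic.
Qed.

End caratheodory.

(** * Independence of one source from the others *)

Lemma bigsetIP (I : eqType) (U : Type) (s : seq I) (f : I -> set U) (z : U) :
  (\big[setI/setT]_(i <- s) f i) z <-> forall i, i \in s -> f i z.
Proof.
elim: s => [|a s IHs]; first by rewrite big_nil.
rewrite big_cons; split => [[fa /IHs fs] i|fs].
  by rewrite inE => /predU1P[->|/fs].
by split; [exact/fs/mem_head|apply/IHs => i si; apply: fs; rewrite inE si orbT].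
Qed.

Section independence.
Context {R : realType} {d : measure_display} {Omega : measurableType d}.
Variable P : probability Omega R.

(** The lambda-system half of the argument: complements use that [P C] is finite, disjoint unions
    use countable additivity. *)
Lemma dynkin_indep (C : set Omega) : measurable C ->
  dynkin [set E | measurable E /\ P (E `&` C) = (P E * P C)%E].
Proof.
move=> mC; split => /=.
- by rewrite setTI probability_setT mul1e.
- move=> E /= [mE PE]; split; first exact: measurableC.
  have -> : P (~` E `&` C) = (P C - P (E `&` C))%E.
    rewrite setIC -setDE measureD//; first by rewrite setIC.
    by rewrite -ge0_fin_numE ?fin_num_measure.
  rewrite PE probability_setC//.
  rewrite -(fineK (fin_num_measure P _ mC)) -(fineK (fin_num_measure P _ mE)).
  by rewrite -EFinM -!EFinB -EFinM mulrBl mul1r.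
- move=> F tF HF; split; first by apply: bigcup_measurable => n _; case: (HF n).
  have mF n : measurable (F n) by case: (HF n).
  rewrite setI_bigcupl !measure_bigcup//; last 2 first.
  + by move=> n _; apply: measurableI.
  + exact: trivIset_setIr.
  rewrite -(fineK (fin_num_measure P _ mC)).
  rewrite muleC -nneseriesZl//.
  apply: eq_eseriesr => n _.
  transitivity (P (F n) * P C)%E; first by case: (HF n).
  by rewrite fineK ?fin_num_measure// muleC.
Qed.

Lemma sub_g_sigma_measurable (G : set (set Omega)) :
  G `<=` measurable -> <<s G >> `<=` measurable.
Proof.
move=> Gm; apply: smallest_sub => //; split => //.
- by move=> A mA; rewrite setTD; exact: measurableC.
- by move=> A mA; exact: bigcupT_measurable.
Qed.

Section one_vs_rest.
Context {I : eqType} (D : set I) (F : I -> set (set Omega)).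
Hypothesis FT : forall i, D i -> F i setT.
Hypothesis FI : forall i, D i -> setI_closed (F i).
Hypothesis Fm : forall i, D i -> F i `<=` measurable.
Hypothesis indep : mutually_independent P D F.

(** Finite intersections of events from the systems indexed by [A] form a pi-system generating the
    sigma-algebra of [E]. On it the product formula is mutual independence, used for [J] and for
    [i0 :: J]. *)
Lemma one_vs_rest_indep (i0 : I) (A : set I) (E C : set Omega) :
  D i0 -> A `<=` D -> ~ A i0 -> <<s \bigcup_(i in A) F i >> E -> F i0 C ->
  P (E `&` C) = (P E * P C)%E.
Proof.
move=> Di0 AD Ai0 sE FC.
pose Pi : set (set Omega) := [set E | exists J : seq I, exists B : I -> set Omega,
  [/\ uniq J, forall i, i \in J -> A i /\ F i (B i) &
      E = \big[setI/setT]_(i <- J) B i]].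
have PiI : setI_closed Pi.
  move=> _ _ [J [B [uJ JB ->]]] [J' [B' [uJ' JB' ->]]].
  (* An index occurring in only one of the two lists contributes [setT] on the other side; this is
     where [FT] is used. *)
  exists (undup (J ++ J')).
  exists (fun i => (if i \in J then B i else setT) `&`
                   (if i \in J' then B' i else setT)).
  split; first exact: undup_uniq.
    move=> i; rewrite mem_undup mem_cat => iJ.
    have Ai : A i by case/orP: iJ => [/JB[]//|/JB'[]].
    split => //; apply: (FI (AD _ Ai)).
      by case: ifPn => [/JB[]//|_]; exact/FT/AD.
    by case: ifPn => [/JB'[]//|_]; exact/FT/AD.
  apply/seteqP; split => z.
    move=> [/bigsetIP zB /bigsetIP zB']; apply/bigsetIP => i _; split.
      by case: ifPn => // /zB.
    by case: ifPn => // /zB'.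
  move=> /bigsetIP h; split; apply/bigsetIP => i iJ.
    by have := h i; rewrite mem_undup mem_cat iJ => /(_ isT)[].
  by have := h i; rewrite mem_undup mem_cat iJ orbT => /(_ isT)[].
have mC : measurable C by exact: Fm FC.
suff : <<d Pi >> `<=` [set E | measurable E /\ P (E `&` C) = (P E * P C)%E].
  move=> /(_ E)[]//; rewrite setI_closed_g_dynkin_g_sigma_algebra//.
  apply: smallest_sub sE; first exact: smallest_sigma_algebra.
  move=> X [i Ai FX]; apply: sub_sigma_algebra.
  exists [:: i], (fun=> X); split => //; last by rewrite big_seq1.
  by move=> k; rewrite inE => /eqP ->.
apply: smallest_sub; first exact: dynkin_indep.
move=> _ [J [B [uJ JB ->]]]; split.
  rewrite big_seq; apply: big_ind => //; first exact: measurableI.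
  by move=> i /JB[/AD/Fm]; exact.
have i0J : i0 \notin J by apply/negP => /JB[].
(* One family for both index lists: it puts [C] at [i0] and agrees with [B] on [J], which does not
   contain [i0]. *)
pose B' i := if i == i0 then C else B i.
have B'0 : B' i0 = C by rewrite /B' eqxx.
have -> : \big[setI/setT]_(i <- J) B i = \big[setI/setT]_(i <- J) B' i.
  by apply: eq_big_seq => i iJ; rewrite /B'; case: eqP => // ii; rewrite -ii iJ in i0J.
have := @indep (i0 :: J) B'.
rewrite /= i0J uJ !big_cons B'0 setIC => ->//.
  rewrite muleC -indep// => i iJ; rewrite /B'; case: eqP => [ii|_].
    by rewrite -ii iJ in i0J.
  by case: (JB i iJ) => Ai ?; split => //; exact: AD.
move=> i; rewrite inE /B'; case: eqP => [->//|_ /= iJ].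
by case: (JB i iJ) => Ai ?; split => //; exact: AD.
Qed.

End one_vs_rest.

(** * Integrating out a variable independent of a sub-sigma-algebra *)

Section fubini.
Local Open Scope ereal_scope.
Context (G : set (set Omega)) {dS : measure_display} {S : measurableType dS}.
Variables (Y : Omega -> S).
Hypothesis Gm : G `<=` measurable.
Hypothesis mY : measurable_fun setT Y.
Hypothesis ind : forall E C, <<s G >> E -> measurable C ->
  P (E `&` Y @^-1` C) = P E * P (Y @^-1` C).

Lemma measurable_fun_sub_sigma d' (S' : measurableType d') (f : Omega -> S') :
  measurable_fun (setT : set (g_sigma_algebraType G)) f -> measurable_fun setT f.
Proof.
move=> mf _ A mA; apply: (sub_g_sigma_measurable Gm).
exact: (mf measurableT A mA).
Qed.

(* [Omega] with the sub-sigma-algebra serves as the first factor: the joint law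
   of (id, Y) is then a product. *)
Lemma indep_fubini (f : (g_sigma_algebraType G) * S -> R) (h : Omega -> R) :
  measurable_fun setT f ->
  P.-integrable setT (fun omega => (f (omega, Y omega))%:E) ->
  (forall omega, P.-integrable setT (fun z => (f (omega, Y z))%:E)) ->
  (forall omega, \int[P]_z (f (omega, Y z))%:E = (h omega)%:E) ->
  P.-integrable setT (EFin \o h) ->
  \int[P]_omega (f (omega, Y omega))%:E = \int[P]_omega (h omega)%:E.
Proof.
move=> mf intf intf1 fh inth.
have mid : measurable_fun setT (id : Omega -> g_sigma_algebraType G).
  by apply: measurable_fun_sub_sigma => _ A mA; rewrite setTI.
pose iU := isMeasurableFun.Build _ _ _ _ _ mid.
pose U : {mfun Omega >-> g_sigma_algebraType G} :=
  MeasurableFun.Pack (MeasurableFun.Class iU).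
pose iV := isMeasurableFun.Build _ _ _ _ _ mY.
pose V : {mfun Omega >-> S} := MeasurableFun.Pack (MeasurableFun.Class iV).
have mUV : measurable_fun setT
    (fun omega => (omega, Y omega) : g_sigma_algebraType G * S).
  exact: measurable_fun_pair.
pose iUV := isMeasurableFun.Build _ _ _ _ _ mUV.
pose UV : {mfun Omega >-> (g_sigma_algebraType G * S)%type} :=
  MeasurableFun.Pack (MeasurableFun.Class iUV).
have mEf : measurable_fun setT (EFin \o f) by exact/measurable_EFinP.
(* Independence is the product formula on rectangles, and these determine the product measure. *)
have joint (A : set (g_sigma_algebraType G * S)) : measurable A ->
  (distribution P U \x distribution P V) A = distribution P UV A.
  move: A; apply: (@product_measure_unique _ _ _ _ _ (distribution P U)
    (distribution P V) (distribution P UV)) => E C mE mC.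
  exact: ind.
have intp : (distribution P U \x distribution P V).-integrable setT (EFin \o f).
  have /integrableP[_ fi] : (distribution P UV).-integrable setT (EFin \o f).
    exact: integrable_pushforward.
  apply/integrableP; split => //; apply: le_lt_trans fi.
  by rewrite (eq_measure_integral (distribution P UV)) => // A mA _; exact: joint.
rewrite -[LHS](@integral_distribution _ _ _ _ _ P UV (EFin \o f))//.
rewrite (eq_measure_integral (distribution P U \x distribution P V)); last first.
  by move=> A mA _; exact/esym/joint.
rewrite -integral12_prod_meas1//.
have Fh x : \int[distribution P V]_y (EFin \o f) (x, y) = (h x)%:E.
  rewrite -fh integral_distribution//; last exact: intf1.
  by apply: measurableT_comp mEf _; exact: measurable_pair1.
(* [h] is the inner integral, so Fubini itself makes it measurable for the sub-sigma-algebra. *)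
have mh : measurable_fun (setT : set (g_sigma_algebraType G)) (EFin \o h).
  have := measurable_fubini_F intp; apply: eq_measurable_fun => x _.
  exact: Fh.
transitivity (\int[distribution P U]_x (EFin \o h) x).
  by apply: eq_integral => x _; exact: Fh.
by rewrite integral_distribution.
Qed.

Lemma indep_expectationM (H : Omega -> R) (psi : S -> R) :
  measurable_fun (setT : set (g_sigma_algebraType G)) H ->
  measurable_fun setT psi ->
  P.-integrable setT (EFin \o H) -> P.-integrable setT (EFin \o (psi \o Y)) ->
  P.-integrable setT (fun omega => (H omega * psi (Y omega))%:E) ->
  (\int[P]_omega (H omega * psi (Y omega)) =
   (\int[P]_omega H omega) * \int[P]_omega psi (Y omega))%R.
Proof.
move=> mH mpsi iH ipsi iHpsi.
rewrite -RintegralZr// /Rintegral; congr fine.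
apply: (@indep_fubini (fun z => H z.1 * psi z.2)%R) => //=.
- apply: measurable_funM; first exact: measurableT_comp.
  exact: measurableT_comp.
- move=> omega; under eq_fun do rewrite EFinM.
  exact: integrableZl.
- move=> omega; under eq_integral do rewrite EFinM.
  rewrite integralZl//= EFinM fineK//.
  exact: integrable_fin_num.
- under [X in _.-integrable _ X]eq_fun do rewrite /= EFinM.
  exact: integrableZr.
Qed.

(** With [omega] frozen, both the weight [H] and the parameter of [f] are constants, and the inner
    integral is [H omega] times zero. This plays the role of centring conditionally on [G]. *)
Lemma indep_mean_zero (H : Omega -> R) (f : Omega -> S -> R) :
  measurable_fun (setT : set (g_sigma_algebraType G)) H ->
  measurable_fun setT (fun z : (g_sigma_algebraType G * S)%type => f z.1 z.2) ->
  P.-integrable setT (fun omega => (H omega * f omega (Y omega))%:E) ->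
  (forall omega, P.-integrable setT (fun z => (f omega (Y z))%:E)) ->
  (forall omega, \int[P]_z (f omega (Y z)) = 0)%R ->
  (\int[P]_omega (H omega * f omega (Y omega)) = 0)%R.
Proof.
move=> mH mf iHf if1 f0.
rewrite /Rintegral (@indep_fubini (fun z => H z.1 * f z.1 z.2)%R (cst 0%R))//=.
- by rewrite integral0.
- by apply: measurable_funM => //; exact: measurableT_comp.
- move=> omega; under eq_fun do rewrite EFinM.
  exact: integrableZl.
- move=> omega; under eq_integral do rewrite EFinM.
  rewrite integralZl//=.
  have := f0 omega; rewrite /Rintegral => f0'.
  by rewrite -(fineK (integrable_fin_num _ (if1 omega)))// f0' mule0.
- exact: integrable0.
Qed.

End fubini.
End independence.

(** * Gaussian moments *)

Section gaussian.
Context {R : realType}.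
Local Notation mu := (@lebesgue_measure R).

(** Change of variables holds for the abstract Radon-Nikodym derivative; this agrees almost
    everywhere with [normal_pdf], both having the same integral over every measurable set. *)
Lemma integral_normal_prob (m s : R) (f : R -> \bar R) : s != 0 ->
  (forall x, 0 <= f x)%E -> measurable_fun setT f ->
  (\int[normal_prob m s]_x f x = \int[mu]_x (f x * (normal_pdf m s x)%:E))%E.
Proof.
move=> s0 f0 mf.
have dom := normal_prob_dominates m s.
rewrite -(Radon_Nikodym_SigmaFinite.change_of_variables dom f0)//.
have intf := Radon_Nikodym_SigmaFinite.f_integrable dom.
apply: ae_eq_integral => //.
- apply: emeasurable_funM => //; exact: measurable_int intf.
- apply: emeasurable_funM => //; apply/measurable_EFinP.
  exact: measurable_normal_pdf.
apply: ae_eqe_mul2l; apply: integral_ae_eq => //.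
- by apply/measurable_EFinP; exact: measurable_normal_pdf.
- move=> E _ mE; rewrite -Radon_Nikodym_SigmaFinite.f_integral//.
Qed.

(* Completing the square turns the tilted density into a translate of it. *)
Lemma normal_mgf (s t : R) : s != 0 ->
  (\int[normal_prob 0 s]_x (expR (t * x))%:E = (expR (t ^+ 2 * s ^+ 2 / 2))%:E)%E.
Proof.
move=> s0; rewrite integral_normal_prob; [|by []| |]; last 2 first.
- by move=> x; rewrite lee_fin expR_ge0.
- apply/measurable_EFinP; apply: (measurableT_comp (@measurable_expR R)).
  have mt : measurable_fun setT (fun x : R => t * x) by apply: measurable_funM.
  exact: mt.
transitivity (\int[mu]_x ((expR (t ^+ 2 * s ^+ 2 / 2))%:E *
    (normal_pdf (t * s ^+ 2) s x)%:E))%E.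
  apply: eq_integral => x _; rewrite -!EFinM; congr (_%:E).
  rewrite /normal_pdf (negbTE s0) /normal_fun mulrCA [RHS]mulrCA -!expRD.
  congr (_ * expR _).
  by field.
rewrite integralZl//; last exact: integrable_normal_pdf.
by rewrite integral_normal_pdf mule1.
Qed.

Lemma expR_ge_quad (z : R) : 0 <= z -> 1 + z + z ^+ 2 / 2 <= expR z.
Proof.
move=> z0.
pose phi (x : R) : R := expR x - (1 + x + x ^+ 2 / 2).
have dphi (x : R) : is_derive x (1 : R) phi (expR x - (1 + x)).
  apply: is_derive_eq.
  by rewrite /GRing.scale/= !mulr1 mulr0 !add0r; field.
have phi0 : phi 0 = 0 by rewrite /phi expR0 expr0n/= mul0r !addr0 subrr.
suff : phi 0 <= phi z by rewrite phi0 /phi subr_ge0.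
clearbody phi; apply: (@ger0_derive1_ndecr R phi 0 z); rewrite ?lexx//.
- move=> x _.
  rewrite derive1E (@derive_val _ _ _ _ _ _ _ (dphi x)) subr_ge0.
  exact: expR_ge1Dx.
- apply: continuous_subspaceT => x.
  by apply: differentiable_continuous; apply/derivable1_diffP; case: (dphi x).
Qed.

(** The coefficient 1 of y^2 is that of the Taylor expansion; a smaller one would lose the exact
    constant s^2 in the second moment. *)
Lemma cosh_ge_quad (y : R) : 2 + y ^+ 2 <= expR y + expR (- y).
Proof.
wlog y0 : y / 0 <= y => [hw|].
  have [|/ltW y0] := leP 0 y; first exact: hw.
  have := hw (- y); rewrite oppr_ge0 sqrrN opprK => /(_ y0).
  by rewrite [X in _ <= X -> _]addrC.
have [p Hp] : {p | p = 1 + y / 2 + (y / 2) ^+ 2 / 2} by eexists.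
have y20 : 0 <= y / 2 by rewrite divr_ge0.
have /= := expR_ge_quad y20; rewrite -Hp => pe.
have yE : y = y / 2 + y / 2 by field.
rewrite yE expRD opprD expRD expRN -yE.
set e := expR (y / 2) in pe *.
have p1 : 1 <= p by rewrite Hp; nra.
have e1 : e * e^-1 = 1 by rewrite divff// gt_eqF// expR_gt0.
have ei0 : 0 < e^-1 by rewrite invr_gt0 expR_gt0.
(* With e = exp(y/2), the claim reads y^2 <= (e - 1/e)^2. *)
suff : y <= e - e^-1.
  move=> ye; have := mulr_ge0 y0 y0; nra.
suff : y * e <= e ^+ 2 - 1.
  move=> H; have := ler_wpM2r (ltW ei0) H.
  rewrite mulrBl mul1r -mulrA e1 mulr1 expr2 -mulrA e1 mulr1; exact.
(* Here p is the quadratic Taylor polynomial of exp at y/2, and p^2 - y p - 1 = y^4 / 64. Passing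
   from p to e >= p adds (e - p)(e + p - y) >= 0. *)
have : y * p <= p ^+ 2 - 1 by rewrite Hp; have := sqr_ge0 (y ^+ 2); nra.
have : y <= p + e by rewrite Hp; nra.
nra.
Qed.

(** Stands in for letting [t] tend to 0, so that coefficients can be compared without limits. *)
Lemma le0_of_le_small (a b c : R) : 0 < c ->
  (forall t, 0 < t -> t <= c -> a <= b * t) -> a <= 0.
Proof.
move=> c0 abt; rewrite leNgt; apply/negP => a0.
(* Small enough that b t <= a / 2, which contradicts a <= b t when a > 0. *)
pose t := Num.min c (a / (2 * (`|b| + 1))).
have b0 : 0 < `|b| + 1 by rewrite ltr_wpDl.
have t0 : 0 < t by rewrite lt_min c0 divr_gt0// mulr_gt0.
have tb : t * (2 * (`|b| + 1)) <= a.
  by rewrite -ler_pdivlMr ?mulr_gt0// /t ge_min lexx orbT.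
have /abt : t <= c by rewrite /t ge_min lexx.
move=> /(_ t0) abt'; have := ler_norm b; nra.
Qed.

End gaussian.

Lemma prob_Rintegral_cst d (T : measurableType d) (R : realType)
  (P : probability T R) (c : R) : \int[P]_z c = c.
Proof.
have := expectation_cst P c; rewrite unlock /Rintegral => H.
exact: (congr1 fine H).
Qed.

Section gaussian_variable.
Context {R : realType} {d : measure_display} {Omega : measurableType d}.
Variable P : probability Omega R.
Variables (X : Omega -> R) (s : R).
Hypothesis mX : measurable_fun setT X.
Hypothesis lawX : forall A, measurable A -> P (X @^-1` A) = normal_law 0 s A.

Let mexp (t : R) : measurable_fun setT (fun x : R => expR (t * x)).
Proof.
apply: (measurableT_comp (@measurable_expR R)).
have mt : measurable_fun setT (fun x : R => t * x) by apply: measurable_funM.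
exact: mt.
Qed.

Let mexpX (t : R) : measurable_fun setT (fun z => expR (t * X z)).
Proof. exact: (measurableT_comp (mexp t) mX). Qed.

Lemma gaussian_mgf (t : R) :
  (\int[P]_z (expR (t * X z))%:E = (expR (t ^+ 2 * s ^+ 2 / 2))%:E)%E.
Proof.
have mX' : measurable_fun setT (X : Omega -> measurableTypeR R) by exact: mX.
pose iX := isMeasurableFun.Build _ _ _ _ _ mX'.
pose X' : {mfun Omega >-> measurableTypeR R} :=
  MeasurableFun.Pack (MeasurableFun.Class iX).
have me : measurable_fun setT (fun x : measurableTypeR R => (expR (t * x))%:E).
  by apply/measurable_EFinP; exact: mexp.
have e0 (x : R) : (0 <= (expR (t * x))%:E)%E by rewrite lee_fin expR_ge0.
rewrite -[LHS](@ge0_integral_distribution _ _ _ _ _ P X' _ me e0).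
(* For zero variance the law is the point mass at 0 and both sides are 1. *)
have [s0|s0] := eqVneq s 0.
  rewrite (eq_measure_integral (\d_(0 : measurableTypeR R))); last first.
    move=> A mA _; have := lawX mA.
    by rewrite /normal_law s0 eqxx.
  by rewrite integral_dirac// diracT mul1e mulr0 s0 expr0n/= mulr0 mul0r.
rewrite -(normal_mgf t s0); apply: eq_measure_integral => A mA _.
by have := lawX mA; rewrite /normal_law (negbTE s0).
Qed.

Lemma integrable_gaussian_exp (t : R) :
  P.-integrable setT (fun z => (expR (t * X z))%:E).
Proof.
apply/integrableP; split; first exact/measurable_EFinP.
under eq_integral do rewrite gee0_abs ?lee_fin ?expR_ge0//.
by rewrite gaussian_mgf ltry.
Qed.

Lemma gaussian_exp (t : R) :
  \int[P]_z expR (t * X z) = expR (t ^+ 2 * s ^+ 2 / 2).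
Proof. by rewrite /Rintegral gaussian_mgf. Qed.

Let ie (t : R) :
  P.-integrable setT (fun z => (expR (t * X z) + expR (- t * X z))%:E).
Proof.
under eq_fun do rewrite EFinD.
by apply: integrableD => //; exact: integrable_gaussian_exp.
Qed.

Lemma gaussian_sqr_integrable : P.-integrable setT (fun z => (X z ^+ 2)%:E).
Proof.
apply: le_integrable (ie 1) => //.
  by apply/measurable_EFinP; exact: measurable_funX.
move=> z _ /=; rewrite lee_fin ger0_norm ?sqr_ge0//.
rewrite ger0_norm ?addr_ge0 ?expR_ge0// mul1r mulN1r.
by have := cosh_ge_quad (X z); lra.
Qed.

Lemma gaussian_integrable : P.-integrable setT (fun z => (X z)%:E).
Proof.
apply: le_integrable (ie 1) => //; first exact/measurable_EFinP.
move=> z _ /=; rewrite lee_fin.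
rewrite [leRHS]ger0_norm ?addr_ge0 ?expR_ge0// mul1r mulN1r.
have := cosh_ge_quad (X z); have := sqr_ge0 (`|X z| - 1).
rewrite -[X in _ -> _ + X <= _ -> _]real_normK ?num_real//; nra.
Qed.

(** An upper bound on exp near 0, obtained from exp(-u) >= 1 - u. *)
Let expR_mul_le (u : R) : expR u * (1 - u) <= 1.
Proof.
have := expR_ge1Dx (- u); have := expR_gt0 u => e0.
by rewrite expRN => h; rewrite -ler_pdivlMl// mulr1.
Qed.

(** Integrating 2 + t^2 X^2 <= e^(tX) + e^(-tX) gives 2 + t^2 V <= 2 exp(t^2 s^2 / 2); comparing the
    coefficients of t^2 as t tends to 0 gives V <= s^2. *)
Lemma gaussian_second_moment : \int[P]_z (X z ^+ 2) <= s ^+ 2.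
Proof.
set V := \int[P]_z _.
have V0 : 0 <= V by apply: Rintegral_ge0 => z _; exact: sqr_ge0.
have H (t : R) : 2 + t ^+ 2 * V <= 2 * expR (t ^+ 2 * s ^+ 2 / 2).
  have -> : 2 * expR (t ^+ 2 * s ^+ 2 / 2) =
      \int[P]_z (expR (t * X z) + expR (- t * X z)).
    rewrite RintegralD//; [|exact: integrable_gaussian_exp..].
    by rewrite !gaussian_exp sqrrN; ring.
  have ic : P.-integrable setT (EFin \o cst (2 : R)).
    by apply: finite_measure_integrable_cst.
  have iX2 : P.-integrable setT (EFin \o (fun z => t ^+ 2 * X z ^+ 2)).
    rewrite /comp; under eq_fun do rewrite EFinM.
    by apply: integrableZl => //; exact: gaussian_sqr_integrable.
  have -> : 2 + t ^+ 2 * V = \int[P]_z (cst 2 z + t ^+ 2 * X z ^+ 2).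
    rewrite RintegralD// RintegralZl//; last exact: gaussian_sqr_integrable.
    by rewrite prob_Rintegral_cst.
  apply: le_Rintegral => //.
    rewrite /comp; under eq_fun do rewrite EFinD.
    exact: integrableD.
    exact: ie.
  move=> z _; rewrite -exprMn mulNr; exact: cosh_ge_quad.
(* The small parameter is the square of the one in [H], hence the square root. The inequality to
   prove is V (1 - u) <= s^2 rearranged. *)
rewrite -subr_le0; apply: (@le0_of_le_small _ _ (V * s ^+ 2 / 2) 1) => // t t0 _.
have := H (Num.sqrt t); rewrite (sqr_sqrtr (ltW t0)) => {}H.
set u := t * s ^+ 2 / 2 in H.
have u0 : 0 <= u by rewrite /u divr_ge0// mulr_ge0 ?sqr_ge0//; exact: ltW.
have s2 := sqr_ge0 s.
(* For u < 1, multiply 2 + t V <= 2 e^u by 1 - u: since e^u (1 - u) <= 1, this leaves t V (1 - u) <=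
   2 u = t s^2. For u >= 1 the left side is nonpositive. *)
suff : V * (1 - u) <= s ^+ 2 by rewrite /u; nra.
have [u1|u1] := leP 1 u; first by nra.
have := expR_mul_le u => E.
have : t * (V * (1 - u)) <= t * s ^+ 2.
  have : t * s ^+ 2 = 2 * u by rewrite /u; field.
  nra.
by rewrite ler_pM2l.
Qed.

(** Integrating 1 + t X <= e^(tX) bounds t m by exp(t^2 s^2 / 2) - 1, which is of order t^2; small t
    of either sign then force m = 0. *)
Lemma gaussian_mean : \int[P]_z X z = 0.
Proof.
set m := \int[P]_z _.
have s2 := sqr_ge0 s.
have H (t : R) : t ^+ 2 * s ^+ 2 <= 1 -> t * m <= t ^+ 2 * s ^+ 2.
  move=> ts.
  have : 1 + t * m <= expR (t ^+ 2 * s ^+ 2 / 2).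
    have ic : P.-integrable setT (EFin \o cst (1 : R)).
      by apply: finite_measure_integrable_cst.
    have iX1 : P.-integrable setT (EFin \o (fun z => t * X z)).
      rewrite /comp; under eq_fun do rewrite EFinM.
      by apply: integrableZl => //; exact: gaussian_integrable.
    have -> : 1 + t * m = \int[P]_z (cst 1 z + t * X z).
      rewrite RintegralD// RintegralZl//; last exact: gaussian_integrable.
      by rewrite prob_Rintegral_cst.
    rewrite -gaussian_exp; apply: le_Rintegral => //.
    - rewrite /comp; under eq_fun do rewrite EFinD.
      exact: integrableD.
    - exact: integrable_gaussian_exp.
    - move=> z _; exact: expR_ge1Dx.
  set u := t ^+ 2 * s ^+ 2 / 2.
  have -> : t ^+ 2 * s ^+ 2 = 2 * u by rewrite /u; field.
  have u0 : 0 <= u by rewrite /u divr_ge0// mulr_ge0 ?sqr_ge0.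
  have u1 : u <= 1 / 2 by rewrite /u; lra.
  have := expR_mul_le u; nra.
(* Below this threshold both t and t s^2 are at most 1, so t^2 s^2 <= 1 as [H] requires. *)
have c0 : 0 < (1 + s ^+ 2)^-1 by rewrite invr_gt0; lra.
have small (t : R) : 0 < t -> t <= (1 + s ^+ 2)^-1 -> t ^+ 2 * s ^+ 2 <= 1.
  move=> t0; rewrite -[X in _ <= X]div1r ler_pdivlMr; last lra.
  by move=> ts; nra.
apply/eqP; rewrite eq_le -oppr_le0; apply/andP; split;
  apply: (@le0_of_le_small _ _ (s ^+ 2) _ c0) => t t0 tc.
- have := H t (small _ t0 tc).
  by rewrite expr2 -mulrA ler_pM2l// mulrC.
- have := H (- t); rewrite sqrrN => /(_ (small _ t0 tc)).
  by rewrite mulNr -mulrN expr2 -mulrA ler_pM2l// mulrC.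
Qed.

End gaussian_variable.

(** * Integrability *)

Section square_integrable.
Context {R : realType} {d : measure_display} {Omega : measurableType d}.
Variable P : probability Omega R.
Implicit Types f g : Omega -> R.

Definition intg f : Prop := P.-integrable setT (EFin \o f).
(** Measurability of [f] is listed separately because that of its square does not imply it. *)
Definition sq_intg f : Prop := measurable_fun setT f /\ intg (fun z => f z ^+ 2).

Lemma intg_measurable f : intg f -> measurable_fun setT f.
Proof. by move=> /measurable_int/measurable_EFinP. Qed.

Lemma intgD f g : intg f -> intg g -> intg (fun z => f z + g z).
Proof.
move=> fi gi; rewrite /intg /comp; under eq_fun do rewrite EFinD.
exact: integrableD.
Qed.

Lemma intgZ (a : R) f : intg f -> intg (fun z => a * f z).
Proof.
move=> fi; rewrite /intg /comp; under eq_fun do rewrite EFinM.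
exact: integrableZl.
Qed.

Lemma intg_cst (a : R) : intg (fun=> a).
Proof. exact: finite_measure_integrable_cst. Qed.

Lemma intg_le f g : measurable_fun setT f -> intg g ->
  (forall z, `|f z| <= g z) -> intg f.
Proof.
move=> mf gi fg; apply: le_integrable gi => //; first exact/measurable_EFinP.
by move=> z _; rewrite lee_fin (le_trans (fg z))// ler_norm.
Qed.

Lemma intg_sum (I : Type) (s : seq I) (p : pred I) (f : I -> Omega -> R) :
  (forall i, p i -> intg (f i)) -> intg (fun z => \sum_(i <- s | p i) f i z).
Proof.
move=> fi; elim: s => [|a s IHs].
  by rewrite /intg; under eq_fun do rewrite big_nil; exact: intg_cst.
rewrite /intg /comp; under eq_fun do rewrite big_cons.
by case pa : (p a) => //; apply: intgD => //; exact: fi.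
Qed.

Lemma Rintegral_sum (I : Type) (s : seq I) (p : pred I) (f : I -> Omega -> R) :
  (forall i, p i -> intg (f i)) ->
  \int[P]_z (\sum_(i <- s | p i) f i z) = \sum_(i <- s | p i) \int[P]_z f i z.
Proof.
move=> fi; elim: s => [|a s IHs].
  rewrite big_nil; under eq_Rintegral do rewrite big_nil.
  exact: prob_Rintegral_cst.
rewrite big_cons; under eq_Rintegral do rewrite big_cons.
case pa : (p a); rewrite -IHs// RintegralD//; first exact: fi.
exact: intg_sum.
Qed.

Lemma sq_intgM f g : sq_intg f -> sq_intg g -> intg (fun z => f z * g z).
Proof.
move=> [mf fi] [mg gi].
apply: (@intg_le _ (fun z => f z ^+ 2 + g z ^+ 2)).
- exact: measurable_funM.
- exact: intgD.
- move=> z; rewrite normrM -(real_normK (num_real (f z))).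
  rewrite -(real_normK (num_real (g z))).
  have := sqr_ge0 (`|f z| - `|g z|); have := normr_ge0 (f z).
  have := normr_ge0 (g z); nra.
Qed.

Lemma sq_intgD f g : sq_intg f -> sq_intg g -> sq_intg (fun z => f z + g z).
Proof.
move=> sf sg; have [mf fi] := sf; have [mg gi] := sg.
split; first exact: measurable_funD.
have -> : (fun z => (f z + g z) ^+ 2) =
    (fun z => (f z ^+ 2 + 2 * (f z * g z)) + g z ^+ 2).
  by apply/funext => z; ring.
by apply: intgD => //; apply: intgD => //; apply: intgZ; exact: sq_intgM.
Qed.

Lemma sq_intg_sum (I : Type) (s : seq I) (f : I -> Omega -> R) :
  (forall i, sq_intg (f i)) -> sq_intg (fun z => \sum_(i <- s) f i z).
Proof.
move=> fi; elim: s => [|a s IHs].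
  under eq_fun do rewrite big_nil.
  by split=> //; exact: intg_cst.
by under eq_fun do rewrite big_cons; exact: sq_intgD.
Qed.

Lemma sq_intg_intg f : sq_intg f -> intg f.
Proof.
move=> sf; have [mf fi] := sf.
apply: (@intg_le _ (fun z => f z ^+ 2 + 1)) => //.
  by apply: intgD => //; exact: intg_cst.
move=> z; rewrite -(real_normK (num_real (f z))).
have := sqr_ge0 (`|f z| - 1); have := normr_ge0 (f z); nra.
Qed.

Lemma intg_le01 (b f : Omega -> R) : measurable_fun setT b ->
  (forall z, 0 <= b z <= 1) -> intg f -> intg (fun z => b z * f z).
Proof.
move=> mb b01 fi.
apply: (@intg_le _ (fun z => `|f z|)).
- by apply: measurable_funM => //; exact: intg_measurable.
- exact: integrable_norm.
- by move=> z; have /andP[? ?] := b01 z; rewrite normrM ger0_norm// ler_piMl.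
Qed.

Lemma law_transfer dX (X : measurableType dX) (D : probability X R)
    (Y : Omega -> X) (g : X -> R) :
  measurable_fun setT Y -> (forall A, measurable A -> P (Y @^-1` A) = D A) ->
  D.-integrable setT (EFin \o g) ->
  intg (g \o Y) /\ \int[P]_z g (Y z) = \int[D]_y g y.
Proof.
move=> mY lawY gi.
have mg : measurable_fun setT (EFin \o g) by exact: measurable_int gi.
pose iY := isMeasurableFun.Build _ _ _ _ _ mY.
pose Y' : {mfun Omega >-> X} := MeasurableFun.Pack (MeasurableFun.Class iY).
have dE (h : X -> \bar R) : (\int[D]_y h y = \int[distribution P Y']_y h y)%E.
  by apply: eq_measure_integral => A mA _; exact/esym/lawY.
have gY : intg (g \o Y).
  have /integrableP[_ gD] := gi.
  apply/integrableP; split.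
    exact: (measurableT_comp mg mY).
  rewrite dE in gD.
  have ma : measurable_fun setT (fun y => `|(EFin \o g) y|%E).
    exact: measurableT_comp.
  by rewrite (@ge0_integral_distribution _ _ _ _ _ P Y' _ ma) in gD.
split => //.
by rewrite /Rintegral dE (@integral_distribution _ _ _ _ _ P Y' _ mg gY).
Qed.

End square_integrable.

(** The negative part is at most |m|, hence has finite integral; were the positive part to have one
    too, [f] would be integrable. *)
Lemma expectation_bounded_below_pinfty d (Omega : measurableType d) (R : realType)
    (P : probability Omega R) (f : Omega -> R) (m : R) :
  measurable_fun setT f -> (forall z, m <= f z) -> ~ intg P f ->
  ('E_P[f] = +oo)%E.
Proof.
move=> mf mlef nf; rewrite unlock.
have mEf : measurable_fun setT (EFin \o f) by exact/measurable_EFinP.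
have fneg : (\int[P]_z (EFin \o f)^\- z < +oo)%E.
  apply: (@le_lt_trans _ _ (\int[P]_z (`|m|)%:E)%E).
    apply: ge0_le_integral => //.
    - exact: measurable_funeneg.
    - move=> z _; rewrite funenegE ge_max; apply/andP; split; rewrite lee_fin//.
      have := ler_norm (- m); rewrite normrN.
      by have := mlef z; lra.
  have := expectation_cst P `|m|; rewrite unlock => ->; exact: ltry.
rewrite integralE.
have fn0 : (0 <= \int[P]_z (EFin \o f)^\- z)%E by exact: integral_ge0.
have -> : (\int[P]_z (EFin \o f)^\+ z = +oo)%E.
  apply/eqP; rewrite -leye_eq leNgt; apply/negP => lt; apply: nf.
  apply/integrableP; split => //.
  have -> : (\int[P]_z `|(EFin \o f) z| =
      \int[P]_z ((EFin \o f)^\+ z + (EFin \o f)^\- z))%E.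
    apply: eq_integral => z _.
    by rewrite -[RHS]/(((EFin \o f)^\+ \+ (EFin \o f)^\-)%E z) -fune_abse.
  rewrite ge0_integralD//; [exact: lte_add_pinfty|..].
  - exact: measurable_funepos.
  - exact: measurable_funeneg.
have : (\int[P]_z (EFin \o f)^\- z)%E \is a fin_num by rewrite ge0_fin_numE.
by move=> /fineK <-.
Qed.

(** * The random mask *)

Section mask.
Context {R : realType} {d : measure_display} {Omega : measurableType d}.
Variables (P : probability Omega R) (n k : nat) (Z : Omega -> {set 'I_n}).
Hypothesis uZ : uniform_positions P k Z.

Lemma measurable_preimage_finset (A : set {set 'I_n}) : measurable (Z @^-1` A).
Proof.
have -> : Z @^-1` A = \bigcup_(S in A) Z @^-1` [set S].
  apply/seteqP; split => [z Az|z [S AS ZS]]; first by exists (Z z).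
  by move: ZS => /= ->.
apply: fin_bigcup_measurable; first exact: finite_finset.
by move=> S _; case: (uZ S).
Qed.

Lemma measurable_mask (j : 'I_n) :
  measurable_fun setT (fun z => (j \notin Z z)%:R : R).
Proof.
move=> _ A mA; rewrite setTI.
have -> : (fun z => (j \notin Z z)%:R) @^-1` A =
    Z @^-1` [set S : {set 'I_n} | A ((j \notin S)%:R)] by [].
exact: measurable_preimage_finset.
Qed.

(** The k-subsets avoiding [j] are those of the other n - 1 positions, so the probability is C(n-1,
    k) / C(n, k) = (n - k) / n. *)
Lemma mask_mean (r : R) (j : 'I_n) : r * n%:R = k%:R -> r < 1 ->
  \int[P]_z (j \notin Z z)%:R = 1 - r.
Proof.
move=> rn r1.
have n0 : (0 < n)%N by case: j => i /=; case: n.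
have nR : 0 < n%:R :> R by rewrite ltr0n.
have kn : (k <= n)%N by rewrite -(ler_nat R) -rn ler_piMl ?ltW.
(* Split according to the value of [Z], since the law is given on singletons. *)
have -> : \int[P]_z (j \notin Z z)%:R =
    \int[P]_z \sum_(S : {set 'I_n} | j \notin S) \1_(Z @^-1` [set S]) z.
  apply: eq_Rintegral => z _.
  have [jZ|jZ] := boolP (j \in Z z) => /=.
    rewrite big1// => S jS; rewrite indicE memNset//= => SZ.
    by rewrite -SZ jZ in jS.
  rewrite (bigD1 (Z z))//= indicE mem_set//= big1 ?addr0// => S /andP[_ SZ].
  by rewrite indicE memNset//= => ZS; rewrite ZS eqxx in SZ.
rewrite Rintegral_sum; last first.
  by move=> S _; apply: integrable_indic => //; case: (uZ S).
transitivity (\sum_(S : {set 'I_n} | (j \notin S) && (#|S| == k))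
    ('C(n, k)%:R^-1 : R)).
  rewrite [RHS]big_mkcondr/=; apply: eq_bigr => S _.
  have [mS PS] := uZ S.
  rewrite /Rintegral integral_indic// setIT.
  have := congr1 fine PS; case: ifP => _; exact.
have -> : \sum_(S : {set 'I_n} | (j \notin S) && (#|S| == k)) ('C(n, k)%:R^-1 : R)
    = 'C(n.-1, k)%:R / 'C(n, k)%:R.
  rewrite sumr_const -[LHS]mulr_natl; congr (_ * _); congr (1 *+ _).
  rewrite -[RHS](_ : 'C(#|[set~ j]%SET|, k) = _); last by rewrite cardsC1 card_ord.
  rewrite -cards_draws; apply: eq_card => S; rewrite !inE finset.subsetC finset.sub1set.
  by rewrite inE; congr (_ && _).
have C0 : 0 < 'C(n, k)%:R :> R by rewrite ltr0n bin_gt0.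
apply: (mulfI (lt0r_neq0 nR)).
rewrite mulrA -natrM mul_bin_down natrM mulfK ?gt_eqF// natrB// -rn.
by ring.
Qed.

End mask.

(** * Noisy SGD with random sparsification *)

Section sgd.
Context (R : realType)
  (dO : measure_display) (Omega : measurableType dO) (P : probability Omega R)
  (dX : measure_display) (X : measurableType dX) (D : probability X R)
  (d B T k : nat) (G r gamma sigma sigma_g Lmin : R)
  (loss : 'rV[R]_d -> X -> R)
  (w : nat -> Omega -> 'rV[R]_d) (x : nat -> 'I_B -> {RV P >-> X})
  (Z : nat -> Omega -> {set 'I_d}) (xi : nat -> Omega -> 'rV[R]_d).
Hypotheses (B_gt0 : (0 < B)%N) (G_gt0 : 0 < G)
  (r_lt1 : r < 1) (rd_k : r * d%:R = k%:R)
  (loss_int : forall v, D.-integrable setT (EFin \o loss v))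
  (loss_diff : forall v y, differentiable (loss ^~ y) v)
  (grad_int : forall v j,
     D.-integrable setT (fun y => (example_grad loss v y 0 j)%:E))
  (grad_exp : forall v, true_grad D loss v = grad (objective D loss) v)
  (L_smooth : smooth G (objective D loss))
  (L_min : forall v, Lmin <= objective D loss v)
  (w1_rv : random_vector (w 1%N))
  (x_law : forall t i A, (1 <= t <= T)%N -> measurable A ->
     P (x t i @^-1` A) = D A)
  (Z_law : forall t, (1 <= t <= T)%N -> uniform_positions P k (Z t))
  (xi_law : forall t, (1 <= t <= T)%N -> isotropic_gaussian P sigma (xi t))
  (indep : mutually_independent P (@sources_upto B T)
     (source_sigma (w 1%N) Z x xi))
  (update : forall t omega, (1 <= t <= T)%N ->
     w t.+1 omega = w t omega - gamma *: hadamard (mask_of (Z t omega))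
       (B%:R^-1 *: (\sum_(i < B) example_grad loss (w t omega) (x t i omega)
                    + xi t omega)))
  (deviation : forall t i, (1 <= t <= T)%N ->
     {ae P, forall omega,
        norm2 (example_grad loss (w t omega) (x t i omega)
               - true_grad D loss (w t omega)) ^+ 2 <= sigma_g ^+ 2}).

Local Notation src := (source_sigma (w 1%N) Z x xi).
Local Notation L := (objective D loss).

(** * The sources of randomness and measurability of the iterates *)

Lemma g_sigma_preimage_sub n (Y : Omega -> 'rV[R]_n) : random_vector Y ->
  g_sigma_preimage (coord Y) `<=` measurable.
Proof.
move=> mY; apply: sub_g_sigma_measurable.
apply: (big_ind (fun H : set (set Omega) => H `<=` measurable)) => //.
  by move=> E F EA FA A [/EA|/FA].
by move=> j _ _ [A mA <-]; exact: (mY j measurableT A mA).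
Qed.

Lemma preimage_coord n (Y : Omega -> 'rV[R]_n) j (A : set R) : measurable A ->
  g_sigma_preimage (coord Y) (coord Y j @^-1` A).
Proof.
move=> mA; apply: sub_sigma_algebra; rewrite (bigD1 j)//=; left.
by exists A => //; rewrite setTI.
Qed.

Lemma setI_closed_sigma (H : set (set Omega)) : setI_closed <<s H >>.
Proof.
move=> A A' hA hA'.
exact: (@measurableI _ (g_sigma_algebraType H) A A' hA hA').
Qed.

Lemma source_setT s : sources_upto T s -> src s setT.
Proof.
case: s => [|t|t i|t] _ /=; try by exists setT; rewrite ?preimage_setT ?setTI.
- exact: (@measurableT _ (g_sigma_algebraType _)).
- exact: (@measurableT _ (g_sigma_algebraType _)).
Qed.

Lemma source_setI s : sources_upto T s -> setI_closed (src s).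
Proof.
case: s => [|t|t i|t] _ /=; try exact: setI_closed_sigma.
- move=> _ _ [A _ <-] [A' _ <-]; exists (A `&` A') => //.
  by rewrite preimage_setI !setTI.
- move=> _ _ [A mA <-] [A' mA' <-]; exists (A `&` A'); first exact: measurableI.
  by rewrite preimage_setI !setTI.
Qed.

Lemma source_measurable s : sources_upto T s -> src s `<=` measurable.
Proof.
case: s => [|t|t i|t] /= tT.
- exact: g_sigma_preimage_sub.
- move=> _ [A _ <-]; rewrite setTI.
  exact: (measurable_preimage_finset (Z_law tT)).
- by move=> _ [A mA <-]; apply: measurable_funP.
- by apply: g_sigma_preimage_sub; case: (xi_law tT).
Qed.

(** Only a generating family: the information carried by the sources in [A] is the sigma-algebra it
    generates, and [sm A f] is measurability of [f] for the latter. *)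
Definition gens (A : set (source B)) : set (set Omega) := \bigcup_(s in A) src s.
Local Notation sm A f :=
  (measurable_fun (setT : set (g_sigma_algebraType (gens A))) f).
Local Notation rest s := (@sources_upto B T `\ s).

Lemma gens_measurable A : A `<=` @sources_upto B T -> gens A `<=` measurable.
Proof. by move=> AT E [s As]; apply: source_measurable; exact: AT. Qed.

Lemma sm_mono A A' dS (S : measurableType dS) (f : Omega -> S) :
  A `<=` A' -> sm A f -> sm A' f.
Proof.
move=> AA mf _ C mC; have := mf measurableT C mC.
apply: smallest_sub; first exact: smallest_sigma_algebra.
move=> E [s As sE]; apply: sub_sigma_algebra; exists s => //; exact: AA.
Qed.

Lemma sm_source A s dS (S : measurableType dS) (f : Omega -> S) : A s ->
  (forall C, measurable C -> src s (f @^-1` C)) -> sm A f.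
Proof.
move=> As sf _ C mC; rewrite setTI; apply: sub_sigma_algebra; exists s => //.
exact: sf.
Qed.

Lemma rest_indep s dS (S : measurableType dS) (Y : Omega -> S) :
  sources_upto T s -> (forall C, measurable C -> src s (Y @^-1` C)) ->
  forall E C, <<s gens (rest s) >> E -> measurable C ->
  P (E `&` Y @^-1` C) = (P E * P (Y @^-1` C))%E.
Proof.
move=> Ts sY E C hE mC.
apply: (one_vs_rest_indep source_setT source_setI source_measurable indep Ts _ _
  hE (sY C mC)).
  by move=> s' [].
by move=> [_]; exact.
Qed.

Lemma rest_sub s : rest s `<=` @sources_upto B T. Proof. by move=> s' []. Qed.

Lemma mask_source t j C : src (Mask t) ((fun z => (j \notin Z t z)%:R : R) @^-1` C).
Proof.
by exists [set S : {set 'I_d} | C ((j \notin S)%:R)] => //; rewrite setTI.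
Qed.

Lemma example_source t i C : measurable C -> src (Example t i) (x t i @^-1` C).
Proof. by move=> mC; exists C => //; rewrite setTI. Qed.

Lemma noise_source t j C : measurable C ->
  src (Noise t) ((fun z => xi t z 0 j) @^-1` C).
Proof. exact: preimage_coord. Qed.

Lemma measurable_loss v : measurable_fun setT (loss v).
Proof. by have /measurable_int/measurable_EFinP := loss_int v. Qed.

Lemma measurable_objective dS (S : measurableType dS) (v : S -> 'rV[R]_d) :
  (forall j, measurable_fun setT (fun z => v z 0 j)) ->
  measurable_fun setT (fun z => L (v z)).
Proof.
move=> mv.
apply: (@measurable_caratheodory _ _ _ _ S S (fun u _ => L u) v id) => //.
move=> _; apply: continuous_of_differentiable; exact: L_smooth.1.
Qed.

(** By [grad_exp] the true gradient is the gradient of the objective, that is, [example_grad] of a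
    loss that ignores the example. *)
Lemma measurable_true_grad dS (S : measurableType dS) (v : S -> 'rV[R]_d) j :
  (forall j, measurable_fun setT (fun z => v z 0 j)) ->
  measurable_fun setT (fun z => true_grad D loss (v z) 0 j).
Proof.
move=> mv; under eq_fun do rewrite grad_exp.
apply: (@measurable_example_grad _ _ _ _ S S (fun u _ => L u) v id) => // u _.
exact: L_smooth.1.
Qed.

(** The update at step t produces [w t.+1], so [w t] depends on the sources up to [t.-1]; for
    [t = 1] only [Init] remains. *)
Lemma measurable_iterate t : (1 <= t <= T.+1)%N ->
  forall j, sm (@sources_upto B t.-1) (fun z => w t z 0 j).
Proof.
elim: t => // -[_ _ j|t IH /= tT j].
  by apply: (@sm_source _ Init) => // C mC; exact: preimage_coord.
have tT' : (1 <= t.+1 <= T)%N by [].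
have mw i : sm (@sources_upto B t.+1) (fun z => w t.+1 z 0 i).
  apply: (@sm_mono (@sources_upto B t)); last by apply: IH; exact: ltnW.
  by case=> [|s|s u|s] //= /andP[-> /leqW].
under eq_fun do rewrite update// !mxE.
apply: measurable_funB; first exact: mw.
apply: measurable_funM => //; apply: measurable_funM.
  apply: (@sm_source _ (Mask t.+1)); first by rewrite /= leqnn.
  by move=> C _; exact: mask_source.
apply: measurable_funM => //; apply: measurable_funD.
  under eq_fun do rewrite summxE.
  apply: measurable_sum => i.
  apply: measurable_example_grad => //; first exact: measurable_loss.
  apply: (@sm_source _ (Example t.+1 i)); first by rewrite /= leqnn.
  by move=> C; exact: example_source.
apply: (@sm_source _ (Noise t.+1)); first by rewrite /= leqnn.
by move=> C; exact: noise_source.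
Qed.

(** * Expected descent over a single step *)

Section step.
Variables (t : nat) (tT : (1 <= t <= T)%N).

Let nab j z : R := true_grad D loss (w t z) 0 j.
Let dev i j z : R := example_grad loss (w t z) (x t i z) 0 j - nab j z.
Let noise j z : R := \sum_(i < B) dev i j z + xi t z 0 j.
Let dir j z : R := nab j z + B%:R^-1 * noise j z.

(** Sources of step [t] are outside the past, so [w t] and the true gradient there are frozen
    whichever of these sources is isolated. *)
Lemma past_rest s : ~ @sources_upto B t.-1 s -> @sources_upto B t.-1 `<=` rest s.
Proof.
move=> ns s' ps'; split; last by move=> /= ss'; apply: ns; rewrite -ss'.
have tT1 : (t.-1 <= T)%N by case/andP: tT => _; apply: leq_trans; exact: leq_pred.
by move: ps'; case: s' => [|u|u i|u] //= /andP[-> /leq_trans]; exact.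
Qed.

Lemma now_not_past : ((1 <= t <= t.-1)%N) = false.
Proof. by move: tT; case: (t) => //= u _; rewrite ltnn. Qed.

Let sm_w s : ~ @sources_upto B t.-1 s -> forall j, sm (rest s) (fun z => w t z 0 j).
Proof.
move=> ns j; apply: sm_mono (past_rest ns) _; apply: measurable_iterate.
by case/andP: tT => -> /leqW.
Qed.

Let sm_nab s j : ~ @sources_upto B t.-1 s -> sm (rest s) (nab j).
Proof. by move=> ns; apply: measurable_true_grad; exact: sm_w. Qed.

Let sm_dev s i j : ~ @sources_upto B t.-1 s -> s <> Example t i ->
  sm (rest s) (dev i j).
Proof.
move=> ns si; apply: measurable_funB; last exact: sm_nab.
apply: measurable_example_grad => //; [exact: measurable_loss|exact: sm_w|].
apply: (@sm_source _ (Example t i)); last by move=> C; exact: example_source.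
by split => //= si'; exact: si.
Qed.

Let sm_xi s j : s <> Noise t -> sm (rest s) (fun z => xi t z 0 j).
Proof.
move=> si; apply: (@sm_source _ (Noise t)); last by move=> C; exact: noise_source.
by split => //= si'; exact: si.
Qed.

Let nMask : ~ @sources_upto B t.-1 (Mask t). Proof. by rewrite /= now_not_past. Qed.
Let nNoise : ~ @sources_upto B t.-1 (Noise t). Proof. by rewrite /= now_not_past. Qed.
Let nEx i : ~ @sources_upto B t.-1 (Example t i).
Proof. by rewrite /= now_not_past. Qed.

Let sm_rest_measurable s (f : Omega -> R) : sm (rest s) f -> measurable_fun setT f.
Proof. by apply: measurable_fun_sub_sigma; apply: gens_measurable; exact: rest_sub. Qed.

Let mnab j : measurable_fun setT (nab j).
Proof. by apply: sm_rest_measurable; exact: (sm_nab _ nMask). Qed.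

Let mdev i j : measurable_fun setT (dev i j).
Proof. by apply: sm_rest_measurable; exact: (sm_dev _ nMask). Qed.

Let sq_intg_xi j : sq_intg P (fun z => xi t z 0 j).
Proof.
have [mxi lxi _] := xi_law tT.
split; first exact: mxi.
exact: (gaussian_sqr_integrable (mxi j) (lxi j)).
Qed.

Let devE i z : norm2 (example_grad loss (w t z) (x t i z)
  - true_grad D loss (w t z)) ^+ 2 = \sum_(j < d) dev i j z ^+ 2.
Proof.
have rowB (u v : 'rV[R]_d) j : (u - v) 0 j = u 0 j - v 0 j by rewrite !mxE.
by rewrite norm2_sqr; apply: eq_bigr => j _; rewrite rowB.
Qed.

(** Integrating the almost sure bound over the probability space gives the integrability and the
    estimate together. *)
Let dev_bound i : intg P (fun z => \sum_(j < d) dev i j z ^+ 2) /\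
  \int[P]_z (\sum_(j < d) dev i j z ^+ 2) <= sigma_g ^+ 2.
Proof.
have mS : measurable_fun setT (fun z => \sum_(j < d) dev i j z ^+ 2).
  by apply: measurable_sum => j; exact: measurable_funX.
have S0 z : 0 <= \sum_(j < d) dev i j z ^+ 2.
  by apply: sumr_ge0 => j _; exact: sqr_ge0.
have le : (\int[P]_z (\sum_(j < d) dev i j z ^+ 2)%:E <= (sigma_g ^+ 2)%:E)%E.
  have := expectation_cst P (sigma_g ^+ 2); rewrite unlock => <-.
  apply: ae_ge0_le_integral => //.
  - by move=> z _; rewrite lee_fin.
  - exact/measurable_EFinP.
  - by move=> z _; rewrite lee_fin sqr_ge0.
  - exact/measurable_EFinP.
  - have [N [mN N0 subN]] := deviation i tT; exists N; split => // z /= nH.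
    by apply: subN => /= H; apply: nH => _; rewrite lee_fin -devE.
have iS : intg P (fun z => \sum_(j < d) dev i j z ^+ 2).
  apply/integrableP; split; first exact/measurable_EFinP.
  under eq_integral do rewrite gee0_abs ?lee_fin//.
  by apply: le_lt_trans le _; rewrite ltry.
split => //.
by rewrite -lee_fin /Rintegral fineK// integrable_fin_num.
Qed.

Let sq_intg_dev i j : sq_intg P (dev i j).
Proof.
split => //; apply: (intg_le _ (dev_bound i).1); first exact: measurable_funX.
move=> z; rewrite ger0_norm ?sqr_ge0// (bigD1 j)//= lerDl.
by apply: sumr_ge0 => l _; exact: sqr_ge0.
Qed.

Let sq_intg_noise j : sq_intg P (noise j).
Proof. by apply: sq_intgD => //; exact: sq_intg_sum. Qed.

Let E_mask j (phi : Omega -> R) : sm (rest (Mask t)) phi -> intg P phi ->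
  \int[P]_z ((j \notin Z t z)%:R * phi z) = (1 - r) * \int[P]_z phi z.
Proof.
move=> mphi iphi.
have mm := measurable_mask (R := R) (Z_law tT) j.
rewrite -(mask_mean (Z_law tT) j rd_k r_lt1) mulrC.
under eq_Rintegral do rewrite mulrC.
have b01 z : 0 <= ((j \notin Z t z)%:R : R) <= 1.
  by case: (j \notin _); rewrite /= ?lexx ?ler01.
apply: (@indep_expectationM _ _ _ P (gens (rest (Mask t))) _ R
  (fun z => (j \notin Z t z)%:R) _ mm _ phi id) => //.
- by apply: gens_measurable; exact: rest_sub.
- by apply: rest_indep => // C _; exact: mask_source.
- apply: (@intg_le _ _ _ P _ (fun=> 1)) => //; first exact: intg_cst.
  by move=> z; have /andP[? ?] := b01 z; rewrite ger0_norm.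
- under [X in _.-integrable _ X]eq_fun do rewrite mulrC.
  exact: intg_le01.
Qed.

(** With [w t] frozen, [x_law] turns the mean of the example gradient into the true gradient. The
    weight [H] may involve the noise and the other examples of the same batch, as the cross terms
    require. *)
Let E_dev i j (H : Omega -> R) : sm (rest (Example t i)) H -> sq_intg P H ->
  \int[P]_z (H z * dev i j z) = 0.
Proof.
move=> mH sH.
have mx : measurable_fun setT (x t i) by exact: measurable_funP.
have transfer v := law_transfer mx (fun A => @x_law t i A tT) (grad_int v j).
have if1 v : intg P (fun z => example_grad loss v (x t i z) 0 j -
    true_grad D loss v 0 j).
  apply: intgD; first exact: (transfer v).1.
  exact: intg_cst.
apply: (@indep_mean_zero _ _ _ P (gens (rest (Example t i))) _ _ (x t i) _ mx _ H
  (fun z y => example_grad loss (w t z) y 0 j - true_grad D loss (w t z) 0 j)) => //.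
- by apply: gens_measurable; exact: rest_sub.
- by apply: rest_indep => // C; exact: example_source.
- have mw l : measurable_fun setT (fun z : (g_sigma_algebraType
      (gens (rest (Example t i))) * X)%type => w t z.1 0 l).
    apply: (measurableT_comp (f := fun z : g_sigma_algebraType
      (gens (rest (Example t i))) => w t z 0 l)); first exact: sm_w.
    exact: measurable_fst.
  apply: measurable_funB; last exact: measurable_true_grad.
  by apply: measurable_example_grad => //; exact: measurable_loss.
- exact: (sq_intgM sH (sq_intg_dev i j)).
- by move=> z; exact: if1.
- move=> z; rewrite RintegralB//; [|exact: (transfer _).1|exact: intg_cst].
  rewrite (transfer _).2 prob_Rintegral_cst.
  by rewrite /true_grad mxE unlock subrr.
Qed.

Let E_xi j (H : Omega -> R) : sm (rest (Noise t)) H -> sq_intg P H ->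
  \int[P]_z (H z * xi t z 0 j) = 0.
Proof.
move=> mH sH.
have [mxi lxi _] := xi_law tT.
rewrite (@indep_expectationM _ _ _ P (gens (rest (Noise t))) _ R
  (fun z => xi t z 0 j) _ (mxi j) _ H id) //.
- by rewrite (gaussian_mean (mxi j) (lxi j)) mulr0.
- by apply: gens_measurable; exact: rest_sub.
- by apply: rest_indep => // C; exact: noise_source.
- exact: sq_intg_intg.
- exact: sq_intg_intg (sq_intg_xi j).
- exact: (sq_intgM sH (sq_intg_xi j)).
Qed.

Let E_noise_sqr j : \int[P]_z (noise j z ^+ 2) <=
  \sum_(i < B) \int[P]_z (dev i j z ^+ 2) + sigma ^+ 2.
Proof.
pose S z := \sum_(i < B) dev i j z.
have sS : sq_intg P S by exact: sq_intg_sum.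
have -> : \int[P]_z (noise j z ^+ 2) =
    \int[P]_z ((S z ^+ 2 + 2 * (S z * xi t z 0 j)) + xi t z 0 j ^+ 2).
  by apply: eq_Rintegral => z _; rewrite /noise -/(S z); ring.
have i1 : intg P (fun z => S z ^+ 2) by case: sS.
have i2 : intg P (fun z => S z * xi t z 0 j) by exact: sq_intgM.
have i3 : intg P (fun z => xi t z 0 j ^+ 2) by case: (sq_intg_xi j).
rewrite RintegralD//; last by apply: intgD => //; exact: intgZ.
rewrite RintegralD//; last exact: intgZ.
rewrite RintegralZl// E_xi//; last first.
  by apply: measurable_sum => i; exact: sm_dev.
rewrite mulr0 addr0; apply: lerD; last first.
  have [mxi lxi _] := xi_law tT.
  exact: (gaussian_second_moment (mxi j) (lxi j)).
rewrite le_eqVlt; apply/orP; left; apply/eqP.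
under eq_Rintegral do rewrite expr2 mulr_suml.
rewrite Rintegral_sum; last by move=> i _; exact: sq_intgM.
apply: eq_bigr => i _.
under eq_Rintegral do rewrite mulr_sumr.
rewrite Rintegral_sum; last by move=> l _; exact: sq_intgM.
(* Off the diagonal, [dev i j] is a weight that does not involve example [l], so [E_dev] applies to
   that example. *)
rewrite (bigD1 i)//= big1 ?addr0// => l li.
apply: E_dev => //; apply: sm_dev => //.
by move=> [] /eqP; rewrite (negbTE li).
Qed.

(** Supplied by the induction over the steps; [expected_descent] returns the same property for
    [w t.+1]. *)
Hypothesis iL : intg P (fun z => L (w t z)).

Let sq_intg_nab j : sq_intg P (nab j).
Proof.
split => //.
apply: (@intg_le _ _ _ P _ (fun z => 2 * G * (L (w t z) - Lmin))).
- exact: measurable_funX.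
- by apply: intgZ; apply: intgD => //; exact: intg_cst.
- move=> z; rewrite ger0_norm ?sqr_ge0//.
  apply: le_trans (norm2_grad_le _ G_gt0 L_smooth L_min).
  rewrite norm2_sqr (bigD1 j)//= /nab grad_exp lerDl.
  by apply: sumr_ge0 => l _; exact: sqr_ge0.
Qed.

Let E_nab_noise j : \int[P]_z (nab j z * noise j z) = 0.
Proof.
under eq_Rintegral do rewrite mulrDr mulr_sumr.
rewrite RintegralD//; last 2 first.
- by apply: intg_sum => i _; exact: sq_intgM.
- exact: sq_intgM.
rewrite E_xi//; last exact: sm_nab.
rewrite addr0 Rintegral_sum; last by move=> i _; exact: sq_intgM.
by apply: big1 => i _; apply: E_dev => //; exact: sm_nab.
Qed.

(** A 0-1 mask equals its square, so the linear and quadratic terms of the descent bound at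
    coordinate [j] share one mask factor; [coef] is what multiplies it. *)
Let coef j z : R := - gamma * (nab j z * dir j z) + G / 2 * gamma ^+ 2 * dir j z ^+ 2.

Let descent_pointwise z :
  L (w t.+1 z) <= L (w t z) + \sum_(j < d) (j \notin Z t z)%:R * coef j z.
Proof.
have rowB (u v : 'rV[R]_d) j : (u - v) 0 j = u 0 j - v 0 j by rewrite !mxE.
have rowN (u : 'rV[R]_d) j : (- u) 0 j = - u 0 j by rewrite mxE.
have rowD (u v : 'rV[R]_d) j : (u + v) 0 j = u 0 j + v 0 j by rewrite mxE.
have rowZ a (u : 'rV[R]_d) j : (a *: u) 0 j = a * u 0 j by rewrite mxE.
rewrite update//; set h := gamma *: _.
have hE j : h 0 j = gamma * ((j \notin Z t z)%:R * dir j z).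
  rewrite /h rowZ /hadamard mxE [mask_of _ _ _]mxE rowZ rowD summxE.
  congr (_ * (_ * _)).
  rewrite /dir /noise /dev sumrB sumr_const card_ord -mulr_natl.
  by field; rewrite pnatr_eq0 -lt0n.
apply: le_trans (smooth_descent (w t z) (- h) G_gt0 L_smooth) _.
rewrite norm2_sqr mulr_sumr -addrA -big_split/= lerD2l; apply: ler_sum => j _.
rewrite rowN hE -grad_exp -/(nab j z) /coef.
have mm : ((j \notin Z t z)%:R : R) ^+ 2 = (j \notin Z t z)%:R.
  by case: (j \notin _); rewrite /= ?expr1n ?expr0n.
rewrite sqrrN !exprMn mm; set m : R := _%:R.
by rewrite le_eqVlt; apply/orP; left; apply/eqP; ring.
Qed.

Let coefE j z : coef j z = ((- gamma + G / 2 * gamma ^+ 2) * nab j z ^+ 2 +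
    (- gamma + G * gamma ^+ 2) / B%:R * (nab j z * noise j z)) +
    (G / 2 * gamma ^+ 2 / B%:R ^+ 2) * noise j z ^+ 2.
Proof. by rewrite /coef /dir; field; rewrite pnatr_eq0 -lt0n. Qed.

Let i1 j : intg P (fun z => nab j z ^+ 2). Proof. by case: (sq_intg_nab j). Qed.
Let i2 j : intg P (fun z => nab j z * noise j z). Proof. exact: sq_intgM. Qed.
Let i3 j : intg P (fun z => noise j z ^+ 2). Proof. by case: (sq_intg_noise j). Qed.

Let intg_coef j : intg P (coef j).
Proof.
have -> : coef j = (fun z => coef j z) by [].
under eq_fun do rewrite coefE.
by apply: intgD; [apply: intgD|]; apply: intgZ.
Qed.

Let E_coef j : \int[P]_z coef j z =
  (- gamma + G / 2 * gamma ^+ 2) * \int[P]_z (nab j z ^+ 2) +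
  (G / 2 * gamma ^+ 2 / B%:R ^+ 2) * \int[P]_z (noise j z ^+ 2).
Proof.
under eq_Rintegral do rewrite coefE.
rewrite RintegralD//; [|by apply: intgD; apply: intgZ|exact: intgZ].
rewrite RintegralD//; [|exact: intgZ|exact: intgZ].
rewrite (@RintegralZl _ _ _ P setT _ _ measurableT (i1 j)).
rewrite (@RintegralZl _ _ _ P setT _ _ measurableT (i2 j)).
rewrite (@RintegralZl _ _ _ P setT _ _ measurableT (i3 j)).
by rewrite E_nab_noise mulr0 addr0.
Qed.

Let sm_coef j : sm (rest (Mask t)) (coef j).
Proof.
have sn : sm (rest (Mask t)) (nab j) by exact: sm_nab.
have sd : sm (rest (Mask t)) (dir j).
  apply: measurable_funD => //; apply: measurable_funM => //.
  apply: measurable_funD; last exact: sm_xi.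
  by apply: measurable_sum => i; exact: sm_dev.
apply: measurable_funD; first by apply: measurable_funM => //; exact: measurable_funM.
by apply: measurable_funM => //; exact: measurable_funX.
Qed.

(** The deviation bound concerns the whole vector, so the sum over coordinates has to be exchanged
    with the one over the batch before it applies. *)
Let sum_noise : \sum_(j < d) \int[P]_z (noise j z ^+ 2) <=
  B%:R * sigma_g ^+ 2 + d%:R * sigma ^+ 2.
Proof.
apply: le_trans (ler_sum _ (fun j _ => E_noise_sqr j)) _.
rewrite big_split/= sumr_const card_ord -[X in _ + X]mulr_natl lerD2r.
rewrite exchange_big/=.
apply: (@le_trans _ _ (\sum_(i < B) sigma_g ^+ 2)).
  apply: ler_sum => i _; apply: le_trans (dev_bound i).2.
  rewrite Rintegral_sum// => j _; by case: (sq_intg_dev i j).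
by rewrite sumr_const card_ord -[leLHS]mulr_natl.
Qed.

Lemma intg_true_grad_sqr :
  intg P (fun z => norm2 (true_grad D loss (w t z)) ^+ 2).
Proof.
by under eq_fun do rewrite norm2_sqr; apply: intg_sum => j _; exact: i1.
Qed.

Lemma measurable_loss_iterate u : (1 <= u <= T.+1)%N ->
  measurable_fun setT (fun z => L (w u z)).
Proof.
move=> uT; apply: measurable_objective => j.
apply: measurable_fun_sub_sigma (measurable_iterate uT j).
apply: gens_measurable; case=> [|s|s i|s] //= /andP[-> su] /=.
all: apply: leq_trans su _; case/andP: uT => _; case: (u) => //.
Qed.

Lemma expected_descent :
  intg P (fun z => L (w t.+1 z)) /\
  \int[P]_z L (w t.+1 z) <= \int[P]_z L (w t z)
    - (1 - r) * (gamma - G / 2 * gamma ^+ 2)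
      * \int[P]_z (norm2 (true_grad D loss (w t z)) ^+ 2)
    + (1 - r) * (G / 2 * gamma ^+ 2)
      * (sigma_g ^+ 2 / B%:R + d%:R * sigma ^+ 2 / B%:R ^+ 2).
Proof.
have B0 : 0 < B%:R :> R by rewrite ltr0n.
have imc j : intg P (fun z => (j \notin Z t z)%:R * coef j z).
  apply: intg_le01 => //; first exact: (measurable_mask (Z_law tT)).
  by move=> z; case: (j \notin _); rewrite /= ?lexx ?ler01.
have iR : intg P (fun z => L (w t z) + \sum_(j < d) (j \notin Z t z)%:R * coef j z).
  by apply: intgD => //; exact: intg_sum.
(* The next loss lies between [Lmin] and an integrable upper bound. *)
have iL1 : intg P (fun z => L (w t.+1 z)).
  apply: (@intg_le _ _ _ P _ (fun z =>
    `|L (w t z) + \sum_(j < d) (j \notin Z t z)%:R * coef j z| + `|Lmin|)).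
  - by apply: measurable_loss_iterate; case/andP: tT.
  - by apply: intgD; [exact: integrable_norm|exact: intg_cst].
  - move=> z; have := descent_pointwise z; have := L_min (w t.+1 z).
    set a := _ + \sum_(_ < _) _ => La aL.
    have := ler_norm a; have := ler_norm (- Lmin); rewrite normrN => na nb.
    rewrite ler_norml; apply/andP; split; last by have := normr_ge0 Lmin; lra.
    by have := normr_ge0 a; lra.
split => //.
apply: (@le_trans _ _
    (\int[P]_z (L (w t z) + \sum_(j < d) (j \notin Z t z)%:R * coef j z))).
  by apply: le_Rintegral.
rewrite RintegralD//; last exact: intg_sum.
rewrite -addrA lerD2l Rintegral_sum//.
under eq_bigr do rewrite E_mask// E_coef.
rewrite -mulr_sumr big_split/= -!mulr_sumr.
have -> : \sum_(j < d) \int[P]_z (nab j z ^+ 2) =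
    \int[P]_z (norm2 (true_grad D loss (w t z)) ^+ 2).
  rewrite -Rintegral_sum//; apply: eq_Rintegral => z _.
  by rewrite norm2_sqr.
set S := \int[P]_z _; set N := \sum_(_ < _) _.
have gG : 0 <= G / 2 * gamma ^+ 2.
  by rewrite mulr_ge0 ?sqr_ge0// divr_ge0// ltW.
have r0 : 0 <= 1 - r by rewrite subr_ge0 ltW.
have nN : N / B%:R ^+ 2 <= sigma_g ^+ 2 / B%:R + d%:R * sigma ^+ 2 / B%:R ^+ 2.
  have -> : sigma_g ^+ 2 / B%:R + d%:R * sigma ^+ 2 / B%:R ^+ 2 =
    (B%:R * sigma_g ^+ 2 + d%:R * sigma ^+ 2) / B%:R ^+ 2.
    by field; rewrite gt_eqF.
  by rewrite ler_pM2r ?invr_gt0 ?exprn_gt0//; exact: sum_noise.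
have := ler_wpM2l (mulr_ge0 r0 gG) nN; lra.
Qed.

End step.

(** * Summation over the steps *)

Lemma intg_loss_iterate : intg P (fun z => L (w 1%N z)) ->
  forall t, (1 <= t <= T.+1)%N -> intg P (fun z => L (w t z)).
Proof.
move=> iL1; elim=> // -[_ _ //|t IH /= tT].
by apply: (expected_descent _ _).1 => //; apply: IH; exact: ltnW.
Qed.

Lemma sum_expected_descent : intg P (fun z => L (w 1%N z)) ->
  (1 - r) * (gamma - G / 2 * gamma ^+ 2)
    * \sum_(1 <= t < T.+1) \int[P]_z (norm2 (true_grad D loss (w t z)) ^+ 2)
  <= \int[P]_z L (w 1%N z) - Lmin
    + T%:R * ((1 - r) * (G / 2 * gamma ^+ 2)
      * (sigma_g ^+ 2 / B%:R + d%:R * sigma ^+ 2 / B%:R ^+ 2)).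
Proof.
move=> iL1; set c := _ * (gamma - _); set K := _ * (_ + _).
(* The last loss is kept so that the induction telescopes; only at [m = T] is it replaced by
   [Lmin]. *)
have H m : (m <= T)%N ->
    c * \sum_(1 <= t < m.+1) \int[P]_z (norm2 (true_grad D loss (w t z)) ^+ 2)
    <= \int[P]_z L (w 1%N z) - \int[P]_z L (w m.+1 z) + m%:R * K.
  elim: m => [_|m IH mT].
    by rewrite big_geq// mulr0 subrr mul0r addr0.
  have mT' : (1 <= m.+1 <= T)%N by [].
  have := (expected_descent mT' (intg_loss_iterate iL1 (t := m.+1) _)).2.
  rewrite /= ltnS (ltnW mT) => /(_ isT); rewrite -/c -/K.
  have := IH (ltnW mT).
  rewrite (big_nat_recr m.+1)//= mulrDr -natr1 mulrDl mul1r; lra.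
apply: le_trans (H T (leqnn T)) _.
rewrite lerD2r lerD2l lerN2.
rewrite -[leLHS](prob_Rintegral_cst P); apply: le_Rintegral => //.
- exact: intg_cst.
- by apply: intg_loss_iterate => //=; rewrite leqnn.
Qed.

End sgd.

Theorem theorem3p2 (R : realType)
  (dO : measure_display) (Omega : measurableType dO) (P : probability Omega R)
  (dX : measure_display) (X : measurableType dX) (D : probability X R)
  (d B T k : nat) (G r gamma sigma sigma_g Lmin : R)
  (loss : 'rV[R]_d -> X -> R)
  (w : nat -> Omega -> 'rV[R]_d) (x : nat -> 'I_B -> {RV P >-> X})
  (Z : nat -> Omega -> {set 'I_d}) (xi : nat -> Omega -> 'rV[R]_d)
  (B_gt0 : (0 < B)%N) (T_gt0 : (0 < T)%N)
  (G_gt0 : 0 < G) (sigma_ge0 : 0 <= sigma)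
  (r_bounds : 0 <= r < 1) (rd_k : r * d%:R = k%:R)
  (gammaE : gamma = 1 / (G * Num.sqrt T%:R))
  (loss_int : forall v, D.-integrable setT (EFin \o loss v))
  (loss_diff : forall v y, differentiable (loss ^~ y) v)
  (grad_int : forall v j,
     D.-integrable setT (fun y => (example_grad loss v y 0 j)%:E))
  (grad_exp : forall v, true_grad D loss v = grad (objective D loss) v)
  (L_smooth : smooth G (objective D loss))
  (L_min : range (objective D loss) Lmin /\
           forall v, Lmin <= objective D loss v)
  (w1_rv : random_vector (w 1%N))
  (x_law : forall t i A, (1 <= t <= T)%N -> measurable A ->
     P (x t i @^-1` A) = D A)
  (Z_law : forall t, (1 <= t <= T)%N -> uniform_positions P k (Z t))
  (xi_law : forall t, (1 <= t <= T)%N -> isotropic_gaussian P sigma (xi t))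
  (indep : mutually_independent P (@sources_upto B T)
     (source_sigma (w 1%N) Z x xi))
  (update : forall t omega, (1 <= t <= T)%N ->
     w t.+1 omega = w t omega - gamma *: hadamard (mask_of (Z t omega))
       (B%:R^-1 *: (\sum_(i < B) example_grad loss (w t omega) (x t i omega)
                    + xi t omega)))
  (deviation : forall t i, (1 <= t <= T)%N ->
     {ae P, forall omega,
        norm2 (example_grad loss (w t omega) (x t i omega)
               - true_grad D loss (w t omega)) ^+ 2 <= sigma_g ^+ 2}) :
  ((T%:R^-1)%:E * (\sum_(1 <= t < T.+1)
       'E_P[(fun omega => norm2 (true_grad D loss (w t omega)) ^+ 2)%R])
   <= (2 * G / ((1 - r) * Num.sqrt T%:R))%:E *
        ('E_P[fun omega => (objective D loss (w 1%N omega))%R] - Lmin%:E)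
      + (1 / Num.sqrt T%:R *
         (sigma_g ^+ 2 / B%:R + d%:R * sigma ^+ 2 / B%:R ^+ 2))%:E)%E.

Proof.
have [r0 r1] := andP r_bounds.
have [_ L_ge] := L_min.
pose L := objective D loss.
have s0 : 0 < Num.sqrt T%:R :> R by rewrite sqrtr_gt0 ltr0n.
have ss : Num.sqrt T%:R ^+ 2 = T%:R :> R by rewrite sqr_sqrtr.
have s1 : 1 <= Num.sqrt T%:R :> R.
  by rewrite -[leLHS]sqrtr1 ler_psqrt ?nnegrE// ler1n.
have r0' : 0 < 1 - r by rewrite subr_gt0.
have c0 : 0 < 2 * G / ((1 - r) * Num.sqrt T%:R) by rewrite divr_gt0 ?mulr_gt0.
have mL1 : measurable_fun setT (fun z => L (w 1%N z)).
  by apply: (measurable_objective L_smooth) => j; exact: w1_rv.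
have [iL1|nL1] := pselect (intg P (fun z => L (w 1%N z))); last first.
  rewrite (expectation_bounded_below_pinfty mL1 (fun z => L_ge (w 1%N z)) nL1).
  by rewrite addye//= gt0_muley ?lte_fin// addye// leey.
have iS t : (1 <= t <= T)%N ->
    intg P (fun z => norm2 (true_grad D loss (w t z)) ^+ 2).
  move=> tT; apply: (intg_true_grad_sqr G_gt0 loss_int loss_diff grad_exp
    L_smooth L_ge w1_rv Z_law xi_law update tT).
  apply: (intg_loss_iterate B_gt0 G_gt0 r1 rd_k loss_int loss_diff grad_int
    grad_exp L_smooth L_ge w1_rv x_law Z_law xi_law indep update deviation iL1).
  by case/andP: tT => -> /leqW.
have := sum_expected_descent B_gt0 G_gt0 r1 rd_k loss_int loss_diff grad_int
  grad_exp L_smooth L_ge w1_rv x_law Z_law xi_law indep update deviation iL1.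
set a1 := \int[P]_z objective _ _ _; set S := \sum_(_ <= _ < _) _.
set C := sigma_g ^+ 2 / _ + _.
move=> HS.
have -> : ('E_P[fun omega => (objective D loss (w 1%N omega))%R] = a1%:E)%E.
  by rewrite unlock /a1 /Rintegral fineK//; exact: integrable_fin_num iL1.
have -> : (\sum_(1 <= t < T.+1)
       'E_P[(fun omega => norm2 (true_grad D loss (w t omega)) ^+ 2)%R] = S%:E)%E.
  rewrite /S -sumEFin; apply: eq_big_nat => t tT.
  by rewrite unlock /Rintegral fineK//; exact: integrable_fin_num (iS t tT).
rewrite -EFinB -!EFinM -EFinD lee_fin.
have S0 : 0 <= S.
  by apply: sumr_ge0 => t _; apply: Rintegral_ge0 => z _; exact: sqr_ge0.
move: HS s0 ss s1 c0; set s := Num.sqrt T%:R => HS s0 ss s1 c0.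
have gE : gamma = (G * s)^-1 by rewrite gammaE div1r.
have Gs0 : 0 < G * s by rewrite mulr_gt0.
(* Both sides are rewritten as multiples of the positive constant 2 G / ((1 - r) s), using gamma = 1
   / (G s) and T = s^2, so that it cancels and [HS] applies. *)
have -> : T%:R^-1 * S = 2 * G / ((1 - r) * s) * ((1 - r) * (gamma / 2) * S).
  by rewrite gE -ss; field; rewrite !gt_eqF.
have -> : 2 * G / ((1 - r) * s) * (a1 - Lmin) + 1 / s * C =
    2 * G / ((1 - r) * s) *
      (a1 - Lmin + T%:R * ((1 - r) * (G / 2 * gamma ^+ 2) * C)).
  by rewrite gE -ss; field; rewrite !gt_eqF.
rewrite ler_pM2l//; apply: le_trans HS.
rewrite ler_wpM2r// ler_wpM2l ?(ltW r0')//.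
(* What remains is gamma / 2 <= gamma - G gamma^2 / 2, which holds because G gamma = 1 / s <= 1. *)
have -> : G / 2 * gamma ^+ 2 = gamma / 2 * s^-1.
  by rewrite gE; field; rewrite !gt_eqF.
have g0 : 0 <= gamma / 2 by rewrite gE divr_ge0// invr_ge0 ltW.
have si : s^-1 <= 1 by rewrite invf_le1.
by have := ler_wpM2l g0 si; lra.
Qed.
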